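(* The free $C^\infty$-ring modality $\mathsf{S}^\infty$ on $\mathbb{R}\text{-}\mathrm{Vec}$ carries the structure of a co-integral category. The integral transformation $\mathsf{s}=\mathsf{d}^\circ\mathsf{K}^{-1}$ carried by $\mathsf{S}^\infty$ sends each smooth 1-form $\omega\in C^\infty(\mathbb{R}^n)\otimes\mathbb{R}^n$ ($n\in\mathbb{N}$) to the function $\mathsf{s}_{\mathbb{R}^n}(\omega)\in C^\infty(\mathbb{R}^n)$ whose value at each $\vec v\in\mathbb{R}^n$ is the integral of $\omega$ along the directed line segment $C_{\vec v}$ from $\vec 0$ to $\vec v$: $$\mathsf{s}_{\mathbb{R}^n}(\omega)(\vec v)=\int_{C_{\vec v}}\omega.$$
   Context: Conventions: composition in diagrammatic order ($fg$ means first $f$, then $g$); associators and unitors suppressed; $\sigma$ denotes the symmetry. $\mathbb{R}\text{-}\mathrm{Vec}$ is the category of real vector spaces with its usual tensor product (unit $k=\mathbb{R}$) and addition of linear maps. Algebra modality on a symmetric monoidal category: a monad $(S,\mu,\eta)$ with natural transformations $\mathsf{m}_C:SC\otimes SC\to SC$, $\mathsf{u}_C:k\to SC$ making each $SC$ a commutative monoid and each $\mu_C$ a monoid morphism. Integral transformation (giving a co-integral category): natural $\mathsf{s}_C:SC\otimes C\to SC$ with [s.1] $(\mathsf{u}\otimes1)\mathsf{s}=\eta$; [s.2] $(\mathsf{s}\otimes\mathsf{s})\mathsf{m}=(\mathsf{s}\otimes1\otimes1)(\mathsf{m}\otimes1)\mathsf{s}+(1\otimes1\otimes\mathsf{s})(1\otimes\sigma)(\mathsf{m}\otimes1)\mathsf{s}$;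 [s.3] $(\mathsf{s}\otimes1)\mathsf{s}=(1\otimes\sigma)(\mathsf{s}\otimes1)\mathsf{s}$. $C^\infty$-rings: a $C^\infty$-ring $(X,\Phi)$ is a set $X$ with an operation $\Phi_f:X^m\to X$ for each smooth $f:\mathbb{R}^m\to\mathbb{R}$, $m\in\mathbb{N}$, such that $\Phi_{\pi_i}$ is the $i$-th projection and $\Phi_{g\circ\langle f_1,\dots,f_m\rangle}=\Phi_g\circ\langle\Phi_{f_1},\dots,\Phi_{f_m}\rangle$; morphisms preserve all operations. Each has an underlying commutative $\mathbb{R}$-algebra (from the polynomial operations). The forgetful functor from $C^\infty$-rings to $\mathbb{R}\text{-}\mathrm{Vec}$ has a left adjoint; $\mathsf{S}^\infty=(S^\infty,\mu,\eta)$ is the induced (finitary) monad, and $\mathsf{m}_V,\mathsf{u}_V$ are the multiplication and unit of the $\mathbb{R}$-algebra underlying the free $C^\infty$-ring $S^\infty(V)$; these form the free $C^\infty$-ring modality. One has $S^\infty(\mathbb{R}^n)=C^\infty(\mathbb{R}^n)$ with operations $\Phi_g(f_1,\dots,f_m)=g\circ\langle f_1,\dots,f_m\rangle$, $\eta_{\mathbb{R}^n}(e_i)=\pi_i$, and $S^\infty(h)(g)=g\circ h^*$ for linear $h$ with transpose $h^*$. $\mathsf{d}:S^\infty(-)\Rightarrow S^\infty(-)\otimes(-)$ is the unique natural transformation with $\mathsf{d}_{\mathbb{R}^n}(f)=\sum_{i=1}^n\frac{\partial f}{\partial x_i}\otimes e_i$ for all $n$ and $f\in C^\infty(\mathbb{R}^n)$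 (natural transformations between finitary endofunctors of $\mathbb{R}\text{-}\mathrm{Vec}$ are determined by, and extend uniquely from, their restrictions to the full subcategory on the spaces $\mathbb{R}^n$). Put $\mathsf{d}^\circ_V=(1\otimes\eta_V)\mathsf{m}_V:S^\infty(V)\otimes V\to S^\infty(V)$ and $\mathsf{K}=\mathsf{d}\mathsf{d}^\circ+S^\infty(0):S^\infty\Rightarrow S^\infty$. The transformation $\mathsf{K}$ is a natural isomorphism, and $\mathsf{s}:=\mathsf{d}^\circ\mathsf{K}^{-1}$. 1-forms: $C^\infty(\mathbb{R}^n)\otimes\mathbb{R}^n$ is identified with the $C^\infty(\mathbb{R}^n)$-module of smooth 1-forms on $\mathbb{R}^n$ by $1\otimes e_i\leftrightarrow\mathsf{d}x_i$; each $\omega$ is uniquely $\sum_{i=1}^nf_i\otimes e_i$ with $f_i\in C^\infty(\mathbb{R}^n)$, and with $F=\langle f_1,\dots,f_n\rangle$ one has $\int_{C_{\vec v}}\omega=\int_0^1F(t\vec v)\cdot\vec v\,\mathsf{d}t$. *)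

(* Defs.v *)
From HB Require Import structures.
From mathcomp Require Import all_boot all_order all_algebra sesquilinear ring.
From mathcomp Require Import all_classical all_reals all_analysis.

Set Implicit Arguments.
Unset Strict Implicit.
Unset Printing Implicit Defensive.
Import Order.TTheory GRing.Theory Num.Theory numFieldNormedType.Exports.
Local Open Scope ring_scope.
Local Open Scope quotient_scope.

Section Smooth.
Variable R : realType.

(* f is k times Frechet differentiable on R^n; smooth is C^oo. *)
Section NDiff.
Variable n : nat.
Fixpoint ndiff (k : nat) (f : 'rV[R]_n -> R) : Prop :=
  if k is k'.+1 then
    (forall x, differentiable f x) /\
    (forall i, ndiff k' ('D_'e_i f))
  else True.
End NDiff.

Definition smooth n (f : 'rV[R]_n -> R) := forall k, ndiff k f.

Lemma ndiffS n k (f : 'rV[R]_n -> R) : ndiff k.+1 f -> ndiff k f.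
Proof.
elim: k f => [//|k IH] f [df Df]; split=> // i.
by apply: IH; apply: Df.
Qed.

Lemma ndiff_cst n k (c : R) : ndiff k (fun _ : 'rV[R]_n => c).
Proof.
elim: k c => [//|k IH] c; split=> [x|i]; first exact: differentiable_cst.
rewrite (_ : 'D_ _ _ = fun=> 0); first exact: IH.
by apply/funext => x; rewrite derive_cst.
Qed.

Lemma ndiffD n k (f g : 'rV[R]_n -> R) :
  ndiff k f -> ndiff k g -> ndiff k (fun x => f x + g x).
Proof.
elim: k f g => [//|k IH] f g [df Df] [dg Dg]; split=> [x|i].
  exact: differentiableD.
rewrite (_ : 'D_ _ _ = fun x => 'D_'e_i f x + 'D_'e_i g x).
  by apply: IH; [exact: Df|exact: Dg].
by apply/funext => x; rewrite deriveD//; apply: diff_derivable.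
Qed.

Lemma ndiffM n k (f g : 'rV[R]_n -> R) :
  ndiff k f -> ndiff k g -> ndiff k (fun x => f x * g x).
Proof.
elim: k f g => [//|k IH] f g F G; have [df Df] := F; have [dg Dg] := G.
split=> [x|i]; first exact: differentiableM.
rewrite (_ : 'D_ _ _ = fun x => f x * 'D_'e_i g x
                          + g x * 'D_'e_i f x).
  by apply: ndiffD; apply: IH; [exact: ndiffS F|exact: Dg|exact: ndiffS G|exact: Df].
by apply/funext => x; rewrite deriveM//; apply: diff_derivable.
Qed.

Lemma ndiff_sum n k m (f : 'I_m -> 'rV[R]_n -> R) :
  (forall j, ndiff k (f j)) -> ndiff k (fun x => \sum_j f j x).
Proof.
elim: m f => [|m IH] f Hf.
  rewrite (_ : (fun _ => _) = fun=> 0); first exact: ndiff_cst.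
  by apply/funext => x; rewrite big_ord0.
rewrite (_ : (fun _ => _) = fun x =>
  (\sum_(j < m) f (widen_ord (leqnSn m) j) x) + f ord_max x).
  by apply: ndiffD => //; apply: IH.
by apply/funext => x; rewrite big_ord_recr.
Qed.

Lemma row_tuple_sum m (a : 'I_m -> R) :
  \row_j a j = \sum_j a j *: delta_mx 0 j.
Proof.
by rewrite [LHS]row_sum_delta; apply: eq_bigr => j _; rewrite mxE.
Qed.

Lemma is_diff_row n m (f : 'I_m -> 'rV[R]_n -> R) (x : 'rV[R]_n) :
  (forall j, differentiable (f j) x) ->
  differentiable (fun y => \row_j f j y : 'rV[R]_m) x.
Proof.
move=> df.
rewrite (_ : (fun _ => _) =
  \sum_j (fun y => f j y *: (delta_mx 0 j : 'rV[R]_m))).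
  by apply: differentiable_sum => j; apply: differentiableZl.
by apply/funext => y; rewrite row_tuple_sum fct_sumE.
Qed.

Lemma derive_row n m (f : 'I_m -> 'rV[R]_n -> R) (x v : 'rV[R]_n) :
  (forall j, differentiable (f j) x) ->
  'D_v (fun y => \row_j f j y : 'rV[R]_m) x = \row_j 'D_v (f j) x.
Proof.
move=> df; rewrite [RHS]row_tuple_sum.
rewrite (_ : (fun _ => _) =
  \sum_j (fun y => f j y *: (delta_mx 0 j : 'rV[R]_m))); last first.
  by apply/funext => y; rewrite row_tuple_sum fct_sumE.
have dfZ j : differentiable (fun y => f j y *: (delta_mx 0 j : 'rV[R]_m)) x.
  exact: differentiableZl.
rewrite derive_sum; last by move=> j; apply: diff_derivable.
apply: eq_bigr => j _.
by rewrite deriveE// diffZl//= deriveE.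
Qed.

Lemma derive_comp_row n m (g : 'rV[R]_m -> R) (f : 'I_m -> 'rV[R]_n -> R)
    (x v : 'rV[R]_n) :
  (forall j, differentiable (f j) x) ->
  differentiable g (\row_j f j x) ->
  'D_v (fun y => g (\row_j f j y)) x =
  \sum_j 'D_'e_j g (\row_j f j x) * 'D_v (f j) x.
Proof.
move=> df dg; pose F y : 'rV[R]_m := \row_j f j y.
have dF : differentiable F x by apply: is_diff_row.
rewrite (_ : (fun _ => _) = g \o F)// deriveE; last exact: differentiable_comp.
rewrite diff_comp//= -[in 'd F x _]deriveE// derive_row// (row_tuple_sum (fun j => 'D_v (f j) x)).
rewrite linear_sum; apply: eq_bigr => j _.
by rewrite linearZ/= [in RHS]mulrC; congr (_ * _); rewrite deriveE.
Qed.

Lemma ndiff_comp n m k (g : 'rV[R]_m -> R) (f : 'I_m -> 'rV[R]_n -> R) :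
  ndiff k g -> (forall j, ndiff k (f j)) ->
  ndiff k (fun x => g (\row_j f j x)).
Proof.
elim: k g f => [//|k IH] g f G F; have [dg Dg] := G.
have df j x : differentiable (f j) x by case: (F j).
split=> [x|i].
  apply: (@differentiable_comp _ _ _ _ (fun x => \row_j f j x) g) => //.
  exact: is_diff_row.
rewrite (_ : 'D_ _ _ = fun x => \sum_j 'D_'e_j g (\row_j f j x) *
                                  'D_'e_i (f j) x).
  apply: ndiff_sum => j; apply: ndiffM; last by case: (F j) => _; apply.
  by apply: (IH ('D_'e_j g)) => [|j']; [exact: Dg|exact: ndiffS].
by apply/funext => x; apply: derive_comp_row.
Qed.

Lemma ndiff_proj n k (i : 'I_n) : ndiff k (fun x : 'rV[R]_n => x 0 i).
Proof.
have dx x : differentiable (fun x : 'rV[R]_n => x 0 i) x.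
  exact: differentiable_coord.
case: k => [//|k]; split=> // j.
rewrite (_ : 'D_ _ _ = fun=> (delta_mx 0 j : 'rV[R]_n) 0 i).
  exact: ndiff_cst.
apply/funext => x; rewrite deriveE//.
have lin : linear (fun x : 'rV[R]_n => x 0 i : R) by move=> a u v; rewrite !mxE.
pose L := GRing.isLinear.Build _ _ _ _ _ lin.
pose f : {linear 'rV[R]_n -> R} := HB.pack (fun x : 'rV[R]_n => x 0 i : R) L.
by rewrite (@diff_lin _ _ _ f)//; apply: coord_continuous.
Qed.

Record Cinf n := MkCinf { Cinf_fun :> 'rV[R]_n -> R; Cinf_smooth : smooth Cinf_fun }.

Lemma Cinf_eq n (f g : Cinf n) : f =1 g -> f = g.
Proof.
case: f g => [f sf] [g sg] /= /funext fg; subst g.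
by congr MkCinf; apply: Prop_irrelevance.
Qed.

End Smooth.

Section CinfOps.
Variable R : realType.

Definition Cinf_cst n (c : R) : Cinf R n := MkCinf (fun k => @ndiff_cst R _ k c).
Definition Cinf_proj n (i : 'I_n) : Cinf R n :=
  MkCinf (fun k => @ndiff_proj R _ k i).
Definition Cinf_comp n m (g : Cinf R m) (f : 'I_m -> Cinf R n) : Cinf R n :=
  MkCinf (fun k => ndiff_comp (Cinf_smooth g k) (fun j => Cinf_smooth (f j) k)).
Definition Cinf_partial n (f : Cinf R n) (i : 'I_n) : Cinf R n :=
  MkCinf (fun k => (Cinf_smooth f k.+1).2 i).

Definition Cinf_add : Cinf R 2 :=
  MkCinf (fun k => ndiffD (@ndiff_proj R _ k 0) (@ndiff_proj R _ k 1)).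
Definition Cinf_mul : Cinf R 2 :=
  MkCinf (fun k => ndiffM (@ndiff_proj R _ k 0) (@ndiff_proj R _ k 1)).
Definition Cinf_scale (c : R) : Cinf R 1 :=
  MkCinf (fun k => ndiffM (@ndiff_cst R _ k c) (@ndiff_proj R _ k 0)).

(* C^oo-rings; an m-tuple of elements of X is a function 'I_m -> X. *)
Record cinfRing := CinfRing {
  cr_sort :> Type;
  cr_op : forall m, Cinf R m -> ('I_m -> cr_sort) -> cr_sort;
  cr_op_proj : forall m (i : 'I_m) x, cr_op (Cinf_proj i) x = x i;
  cr_op_comp : forall n m (g : Cinf R m) (f : 'I_m -> Cinf R n) x,
    cr_op (Cinf_comp g f) x = cr_op g (fun j => cr_op (f j) x) }.

Definition tup0 T : 'I_0 -> T := fun i => match notF (ltn_ord i) with end.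
Definition tup1 T (x : T) : 'I_1 -> T := fun=> x.
Definition tup2 T (x y : T) : 'I_2 -> T := fun i => if i == 0 then x else y.
Definition tup3 T (x y z : T) : 'I_3 -> T :=
  fun i => if i == 0 then x else if i == 1 then y else z.

(* The underlying commutative R-algebra, from the polynomial operations.  The
   trivial C^oo-ring is allowed, so X is only a comPzRingType: together with the
   lmodType structure and cr_scalerAl this is a possibly zero R-algebra, which
   MathComp's algType excludes. *)
Section Algebra.
Variable X : cinfRing.
Implicit Types x y z : X.

Definition cr_zero : X := cr_op (Cinf_cst 0 0) (@tup0 X).
Definition cr_one : X := cr_op (Cinf_cst 0 1) (@tup0 X).
Definition cr_add x y : X := cr_op Cinf_add (tup2 x y).
Definition cr_mul x y : X := cr_op Cinf_mul (tup2 x y).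
Definition cr_scale c x : X := cr_op (Cinf_scale c) (tup1 x).
Definition cr_opp x : X := cr_scale (-1) x.

Section Env.
Variables (n : nat) (e : 'I_n -> X).
Let ev (f : Cinf R n) := cr_op f e.

Lemma cr_zeroE : cr_zero = ev (Cinf_comp (Cinf_cst 0 0) (@tup0 _)).
Proof. by rewrite /ev cr_op_comp; congr cr_op; apply/funext; case. Qed.
Lemma cr_oneE : cr_one = ev (Cinf_comp (Cinf_cst 0 1) (@tup0 _)).
Proof. by rewrite /ev cr_op_comp; congr cr_op; apply/funext; case. Qed.
Lemma cr_addE f g : cr_add (ev f) (ev g) = ev (Cinf_comp Cinf_add (tup2 f g)).
Proof.
rewrite /ev cr_op_comp; congr cr_op; apply/funext => i.
by rewrite /tup2; case: ifP.
Qed.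
Lemma cr_mulE f g : cr_mul (ev f) (ev g) = ev (Cinf_comp Cinf_mul (tup2 f g)).
Proof.
rewrite /ev cr_op_comp; congr cr_op; apply/funext => i.
by rewrite /tup2; case: ifP.
Qed.
Lemma cr_scaleE c f :
  cr_scale c (ev f) = ev (Cinf_comp (Cinf_scale c) (tup1 f)).
Proof. by rewrite /ev cr_op_comp. Qed.
End Env.

Lemma tup3E (T : Type) (x y z : T) :
  (tup3 x y z 0 = x) * (tup3 x y z 1 = y) * (tup3 x y z (inord 2) = z).
Proof.
by rewrite /tup3 !eqxx /= -!val_eqE /= inordK.
Qed.

(* Identities in three variables hold in X as soon as they hold between the
   corresponding smooth functions on R^3. *)
Lemma cr_env (P : X -> X -> X -> Prop) :
  (forall (e : 'I_3 -> X),
     P (cr_op (Cinf_proj 0) e) (cr_op (Cinf_proj 1) e)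
       (cr_op (Cinf_proj (inord 2)) e)) ->
  forall x y z, P x y z.
Proof.
by move=> H x y z; have := H (tup3 x y z); rewrite !cr_op_proj !tup3E.
Qed.

Ltac cr_solve e :=
  rewrite /cr_opp ?(cr_zeroE e) ?(cr_oneE e) ?(cr_addE, cr_mulE, cr_scaleE);
  congr cr_op; apply: Cinf_eq => v /=; rewrite ?mxE /= ?mxE /=;
  try ring.

Lemma cr_addA : associative cr_add.
Proof. by apply: cr_env => e; cr_solve e. Qed.
Lemma cr_addC : commutative cr_add.
Proof.
by move=> x y; apply: (@cr_env (fun x y _ => _ x y = _ y x)) => // e; cr_solve e.
Qed.
Lemma cr_add0 : left_id cr_zero cr_add.
Proof.
by move=> x; apply: (@cr_env (fun x _ _ => cr_add _ x = x)) => // e; cr_solve e.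
Qed.
Lemma cr_addN : left_inverse cr_zero cr_opp cr_add.
Proof.
move=> x; apply: (@cr_env (fun x _ _ => cr_add (cr_opp x) x = _)) => // e.
by cr_solve e.
Qed.
Lemma cr_mulA : associative cr_mul.
Proof. by apply: cr_env => e; cr_solve e. Qed.
Lemma cr_mulC : commutative cr_mul.
Proof.
by move=> x y; apply: (@cr_env (fun x y _ => _ x y = _ y x)) => // e; cr_solve e.
Qed.
Lemma cr_mul1 : left_id cr_one cr_mul.
Proof.
by move=> x; apply: (@cr_env (fun x _ _ => cr_mul _ x = x)) => // e; cr_solve e.
Qed.
Lemma cr_mulDl : left_distributive cr_mul cr_add.
Proof. by apply: cr_env => e; cr_solve e. Qed.
Lemma cr_scaleA a b x : cr_scale a (cr_scale b x) = cr_scale (a * b) x.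
Proof.
apply: (@cr_env (fun x _ _ => cr_scale a (cr_scale b x) = _ x)) => // e.
by cr_solve e.
Qed.
Lemma cr_scale1 : left_id 1 cr_scale.
Proof.
by move=> x; apply: (@cr_env (fun x _ _ => cr_scale 1 x = x)) => // e; cr_solve e.
Qed.
Lemma cr_scaleDr : right_distributive cr_scale cr_add.
Proof.
move=> a x y.
apply: (@cr_env (fun x y _ => cr_scale a (cr_add x y) = cr_add _ _)) => // e.
by cr_solve e.
Qed.
Lemma cr_scaleDl x : {morph cr_scale^~ x : a b / a + b >-> cr_add a b}.
Proof.
move=> a b.
apply: (@cr_env (fun x _ _ => cr_scale _ x = cr_add (_ x) (_ x))) => // e.
by cr_solve e.
Qed.
Lemma cr_scaleAl a x y : cr_scale a (cr_mul x y) = cr_mul (cr_scale a x) y.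
Proof.
apply: (@cr_env (fun x y _ => cr_scale a (cr_mul x y) = cr_mul _ y)) => // e.
by cr_solve e.
Qed.

HB.instance Definition _ := gen_eqMixin (cr_sort X).
HB.instance Definition _ := gen_choiceMixin (cr_sort X).
HB.instance Definition _ :=
  GRing.isZmodule.Build (cr_sort X) cr_addA cr_addC cr_add0 cr_addN.
HB.instance Definition _ :=
  GRing.Zmodule_isComPzRing.Build (cr_sort X) cr_mulA cr_mulC cr_mul1 cr_mulDl.
HB.instance Definition _ := GRing.Zmodule_isLmodule.Build R (cr_sort X)
  cr_scaleA cr_scale1 cr_scaleDr cr_scaleDl.

Lemma cr_scalerAl a (x y : X) : a *: (x * y) = a *: x * y.
Proof. exact: cr_scaleAl. Qed.
End Algebra.

Record cinfHom (X Y : cinfRing) := CinfHom {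
  ch_fun :> X -> Y;
  ch_op : forall m (f : Cinf R m) (x : 'I_m -> X),
    ch_fun (cr_op f x) = cr_op f (fun i => ch_fun (x i)) }.

Section HomLinear.
Variables (X Y : cinfRing) (h : cinfHom X Y).

Lemma ch_linear : linear (ch_fun h).
Proof.
move=> a x y; rewrite /GRing.add /GRing.scale /=.
rewrite /cr_add /cr_scale !ch_op; congr cr_op; apply/funext => i.
rewrite /tup2; case: ifP => // _; rewrite ch_op.
by [].
Qed.
HB.instance Definition _ :=
  GRing.isLinear.Build R X Y *:%R (ch_fun h) ch_linear.

Lemma ch_multiplicative : monoid_morphism (ch_fun h).
Proof.
split=> [|x y]; rewrite /GRing.mul /GRing.one /=.
  by rewrite /cr_one ch_op; congr cr_op; apply/funext; case.
by rewrite /cr_mul ch_op; congr cr_op; apply/funext => i; rewrite /tup2; case: ifP.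
Qed.
HB.instance Definition _ :=
  GRing.isMonoidMorphism.Build X Y (ch_fun h) ch_multiplicative.
End HomLinear.

(* C^oo(R^n) as a C^oo-ring: the operations are post-composition. *)
Definition Cinf_op n m (g : Cinf R m) (f : 'I_m -> Cinf R n) := Cinf_comp g f.
Lemma Cinf_op_proj n m (i : 'I_m) (f : 'I_m -> Cinf R n) :
  Cinf_op (Cinf_proj i) f = f i.
Proof. by apply: Cinf_eq => x /=; rewrite mxE. Qed.
Lemma Cinf_op_comp n m p (g : Cinf R p) (f : 'I_p -> Cinf R m)
    (x : 'I_m -> Cinf R n) :
  Cinf_op (Cinf_comp g f) x = Cinf_op g (fun j => Cinf_op (f j) x).
Proof.
apply: Cinf_eq => y /=; congr (g _); apply/rowP => j; rewrite !mxE.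
Qed.
Definition Cinf_ring n : cinfRing :=
  @CinfRing (Cinf R n) (@Cinf_op n) (@Cinf_op_proj n) (@Cinf_op_comp n).

Lemma Cinf_ringD n (f g : Cinf_ring n) x : (f + g : Cinf_ring n) x = f x + g x.
Proof. by rewrite /= !mxE. Qed.
Lemma Cinf_ringM n (f g : Cinf_ring n) x : (f * g : Cinf_ring n) x = f x * g x.
Proof. by rewrite /= !mxE. Qed.
Lemma Cinf_ringZ n a (f : Cinf_ring n) x : (a *: f : Cinf_ring n) x = a * f x.
Proof. by rewrite /= !mxE. Qed.
End CinfOps.

(* The free C^oo-ring on a vector space V, as formal smooth expressions in the
   vectors of V, two expressions being identified when they take the same value
   under every linear map from V to a C^oo-ring.  Sinf_lift, Sinf_lift_eta and
   Sinf_hom_ext give the universal property: Sinf is left adjoint to the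
   forgetful functor from C^oo-rings to R-vector spaces, with unit Sinf_eta. *)
Section Free.
Variables (R : realType) (V : lmodType R).

Inductive fterm := FVar of V | FOp m of Cinf R m & ('I_m -> fterm).

Fixpoint feval (X : cinfRing R) (h : V -> X) (t : fterm) : X :=
  match t with
  | FVar v => h v
  | FOp m f s => cr_op f (fun i => feval h (s i))
  end.

Definition feq (s t : fterm) : Prop :=
  forall (X : cinfRing R) (h : {linear V -> X}), feval h s = feval h t.

HB.instance Definition _ := gen_eqMixin fterm.
HB.instance Definition _ := gen_choiceMixin fterm.

Lemma feqb_refl : reflexive (fun s t => `[< feq s t >]).
Proof. by move=> s; apply/asboolP. Qed.
Lemma feqb_sym : symmetric (fun s t => `[< feq s t >]).
Proof. by move=> s t; apply/asboolP/asboolP => st X h; rewrite st. Qed.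
Lemma feqb_trans : transitive (fun s t => `[< feq s t >]).
Proof.
by move=> t s u /asboolP st /asboolP tu; apply/asboolP => X h; rewrite st tu.
Qed.
Canonical feq_equiv := EquivRel _ feqb_refl feqb_sym feqb_trans.

Definition Sinf_sort := {eq_quot feq_equiv}.
HB.instance Definition _ := Quotient.on Sinf_sort.
HB.instance Definition _ := EqQuotient.on Sinf_sort.

Definition Sinf_eval (X : cinfRing R) (h : V -> X) (x : Sinf_sort) : X :=
  feval h (repr x).

Lemma Sinf_eval_pi (X : cinfRing R) (h : {linear V -> X}) t :
  Sinf_eval h (\pi_Sinf_sort t) = feval h t.
Proof. by rewrite /Sinf_eval; case: piP => s /eqmodP/asboolP ->. Qed.

Lemma Sinf_eval_inj (x y : Sinf_sort) :
  (forall (X : cinfRing R) (h : {linear V -> X}),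
    Sinf_eval h x = Sinf_eval h y) -> x = y.
Proof.
move=> H; rewrite -[x]reprK -[y]reprK; apply/eqmodP/asboolP => X h.
exact: H.
Qed.

Definition Sinf_op m (f : Cinf R m) (x : 'I_m -> Sinf_sort) : Sinf_sort :=
  \pi_Sinf_sort (FOp f (fun i => repr (x i))).

Lemma Sinf_evalE (X : cinfRing R) (h : {linear V -> X}) m (f : Cinf R m) x :
  Sinf_eval h (Sinf_op f x) = cr_op f (fun i => Sinf_eval h (x i)).
Proof. exact: Sinf_eval_pi. Qed.

Lemma Sinf_op_proj m (i : 'I_m) x : Sinf_op (Cinf_proj R i) x = x i.
Proof. by apply: Sinf_eval_inj => X h; rewrite Sinf_evalE cr_op_proj. Qed.

Lemma Sinf_op_comp n m (g : Cinf R m) (f : 'I_m -> Cinf R n) x :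
  Sinf_op (Cinf_comp g f) x = Sinf_op g (fun j => Sinf_op (f j) x).
Proof.
apply: Sinf_eval_inj => X h; rewrite !Sinf_evalE cr_op_comp.
by congr cr_op; apply/funext => j; rewrite Sinf_evalE.
Qed.

Definition Sinf : cinfRing R := CinfRing Sinf_op_proj Sinf_op_comp.

Definition Sinf_lift_fun (X : cinfRing R) (h : {linear V -> X}) : Sinf -> X :=
  Sinf_eval h.
Definition Sinf_lift (X : cinfRing R) (h : {linear V -> X}) : cinfHom Sinf X :=
  @CinfHom R Sinf X (Sinf_lift_fun h) (@Sinf_evalE X h).

Definition Sinf_eta_fun (v : V) : Sinf := \pi_Sinf_sort (FVar v).

Lemma Sinf_eta_linear : linear Sinf_eta_fun.
Proof.
move=> a u v; apply: Sinf_eval_inj => X h.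
rewrite -[RHS]/(Sinf_lift h _) linearP /=.
by rewrite /Sinf_lift_fun !Sinf_eval_pi /= linearP.
Qed.
HB.instance Definition _ :=
  GRing.isLinear.Build R V Sinf *:%R Sinf_eta_fun Sinf_eta_linear.

Definition Sinf_eta : {linear V -> Sinf} := Sinf_eta_fun.

Lemma Sinf_lift_eta (X : cinfRing R) (h : {linear V -> X}) v :
  Sinf_lift h (Sinf_eta v) = h v.
Proof. exact: Sinf_eval_pi. Qed.

Lemma Sinf_hom_ext (X : cinfRing R) (f g : cinfHom Sinf X) :
  (forall v, f (Sinf_eta v) = g (Sinf_eta v)) -> f =1 g.
Proof.
move=> fg x; rewrite -[x]reprK; elim: (repr x) => [v|m c s IH]; first exact: fg.
have -> : \pi_Sinf_sort (FOp c s) =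
    cr_op c (fun i => \pi_Sinf_sort (s i) : Sinf).
  by apply: Sinf_eval_inj => X' h; rewrite Sinf_evalE Sinf_eval_pi /=;
    congr cr_op; apply/funext => i; rewrite Sinf_eval_pi.
by rewrite !ch_op; congr cr_op; apply/funext => i; apply: IH.
Qed.
End Free.

Section FreeMonad.
Variable R : realType.
Implicit Types V W : lmodType R.

(* Functor and multiplication of the monad induced by the adjunction. *)
Definition Sinf_map V W (h : {linear V -> W}) : {linear Sinf V -> Sinf W} :=
  Sinf_lift (Sinf_eta W \o h).
Definition Sinf_mu V : {linear Sinf (Sinf V) -> Sinf V} :=
  Sinf_lift (idfun : {linear Sinf V -> Sinf V}).

(* The identification of C^oo(R^n) with the free C^oo-ring on R^n, under which
   'e_i corresponds to the i-th projection: f |-> f('e_0, ..., 'e_(n-1)).  Its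
   inverse Cinf_of_Sinf is the C^oo-ring morphism extending 'e_i |-> pi_i. *)
Definition Sinf_of_Cinf n (f : Cinf R n) : Sinf 'rV[R]_n :=
  cr_op f (fun i => Sinf_eta 'rV[R]_n 'e_i).

Definition coord_fun n (v : 'rV[R]_n) : Cinf_ring R n :=
  \sum_i v 0 i *: (Cinf_proj R i : Cinf_ring R n).
Lemma coord_funE n (v x : 'rV[R]_n) : coord_fun v x = \sum_i v 0 i * x 0 i.
Proof.
rewrite /coord_fun (big_morph (fun f : Cinf_ring R n => f x) (id1 := 0)
  (op1 := +%R)); last 2 first.
- exact: (fun f g => Cinf_ringD f g x).
- by [].
by apply: eq_bigr => i _; rewrite Cinf_ringZ.
Qed.
Lemma coord_linear n : linear (@coord_fun n).
Proof.
move=> a u v; rewrite /coord_fun scaler_sumr -big_split; apply: eq_bigr => i _.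
by rewrite !mxE scalerDl scalerA.
Qed.
HB.instance Definition _ n :=
  GRing.isLinear.Build R 'rV[R]_n (Cinf_ring R n) *:%R (@coord_fun n)
   (@coord_linear n).

Definition Cinf_of_Sinf n : cinfHom (Sinf 'rV[R]_n) (Cinf_ring R n) :=
  Sinf_lift (@coord_fun n : {linear _ -> _}).

Lemma Sinf_of_CinfK n : cancel (@Sinf_of_Cinf n) (@Cinf_of_Sinf n).
Proof.
move=> f; rewrite /Sinf_of_Cinf ch_op /=.
rewrite (_ : (fun i => _) = @Cinf_proj R n).
  by apply: Cinf_eq => x /=; congr (f _); apply/rowP => i; rewrite mxE.
apply/funext => i; rewrite [LHS]Sinf_lift_eta; apply: Cinf_eq => x.
rewrite coord_funE (bigD1 i)//= mxE !eqxx mul1r big1 ?addr0// => j /negPf ji.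
by rewrite mxE eqxx ji mul0r.
Qed.

Lemma Sinf_of_Cinf_op n m (g : Cinf R m) (f : 'I_m -> Cinf_ring R n) :
  @Sinf_of_Cinf n (cr_op g f) = cr_op g (fun i => Sinf_of_Cinf (f i)).
Proof. exact: cr_op_comp. Qed.

Lemma Cinf_of_SinfK n : cancel (@Cinf_of_Sinf n) (@Sinf_of_Cinf n).
Proof.
pose i : cinfHom (Cinf_ring R n) (Sinf 'rV[R]_n) :=
  CinfHom (@Sinf_of_Cinf_op n).
have comp_op m (g : Cinf R m) (x : 'I_m -> Sinf 'rV[R]_n) :
  i (Cinf_of_Sinf n (cr_op g x)) = cr_op g (fun k => i (Cinf_of_Sinf n (x k))).
  by rewrite !ch_op.
pose ic : cinfHom (Sinf 'rV[R]_n) (Sinf 'rV[R]_n) := @CinfHom R _ _ (fun x => i (Cinf_of_Sinf n x)) comp_op.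
have id_op m (g : Cinf R m) (x : 'I_m -> Sinf 'rV[R]_n) :
  idfun (cr_op g x) = cr_op g (fun k => idfun (x k)) by [].
have E : ic =1 @CinfHom R _ _ idfun id_op; last exact: E.
apply: Sinf_hom_ext => v; rewrite [RHS]/= [LHS]/=.
rewrite [X in Sinf_of_Cinf X]Sinf_lift_eta /= /coord_fun.
rewrite -[LHS]/(i _) linear_sum [v in RHS]row_sum_delta linear_sum.
apply: eq_bigr => k _; rewrite !linearZ.
exact: (congr1 (fun z : Sinf 'rV[R]_n => v 0 k *: z) (cr_op_proj k _)).
Qed.
End FreeMonad.

(* The tensor product of vector spaces: formal sums of pairs (a, b) modulo
   having the same image under every bilinear map.  The universal property is
   given by tens_bilinear, tlift, tliftE and tensor_ext. *)
Section Tensor.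
Variables (R : realType) (A B : lmodType R).

Definition tsum (W : lmodType R) (f : A -> B -> W) (s : seq (A * B)) : W :=
  \sum_(p <- s) f p.1 p.2.

Definition teq (s t : seq (A * B)) : Prop :=
  forall (W : lmodType R) (f : A -> B -> W), bilinear_for *:%R *:%R f ->
    tsum f s = tsum f t.

Definition fsum := seq (A * B).
HB.instance Definition _ := gen_eqMixin fsum.
HB.instance Definition _ := gen_choiceMixin fsum.

Lemma teqb_refl : reflexive (fun s t : fsum => `[< teq s t >]).
Proof. by move=> s; apply/asboolP. Qed.
Lemma teqb_sym : symmetric (fun s t : fsum => `[< teq s t >]).
Proof. by move=> s t; apply/asboolP/asboolP => st W f bf; rewrite st. Qed.
Lemma teqb_trans : transitive (fun s t : fsum => `[< teq s t >]).
Proof.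
move=> t s u /asboolP st /asboolP tu; apply/asboolP => W f bf.
by rewrite st// tu.
Qed.
Canonical teq_equiv := EquivRel _ teqb_refl teqb_sym teqb_trans.

Definition tensor := {eq_quot teq_equiv}.
HB.instance Definition _ := Choice.on tensor.
HB.instance Definition _ := Quotient.on tensor.
HB.instance Definition _ := EqQuotient.on tensor.

Definition tlift_fun (W : lmodType R) (f : A -> B -> W) (x : tensor) : W :=
  tsum f (repr x).

Lemma tlift_pi (W : lmodType R) (f : A -> B -> W) (s : fsum) :
  bilinear_for *:%R *:%R f -> tlift_fun f (\pi_tensor s) = tsum f s.
Proof. by rewrite /tlift_fun; case: piP => t /eqmodP/asboolP st bf; rewrite st. Qed.

Lemma tlift_inj (x y : tensor) :
  (forall (W : lmodType R) (f : A -> B -> W), bilinear_for *:%R *:%R f ->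
    tlift_fun f x = tlift_fun f y) -> x = y.
Proof.
by move=> H; rewrite -[x]reprK -[y]reprK; apply/eqmodP/asboolP => W f /H.
Qed.

Definition tadd (x y : tensor) : tensor :=
  \pi_tensor (repr x ++ repr y : fsum).
Definition tzero : tensor := \pi_tensor ([::] : fsum).
Definition tscale (a : R) (x : tensor) : tensor :=
  \pi_tensor ([seq (a *: p.1, p.2) | p <- repr x] : fsum).
Definition topp := tscale (-1).

Section Lift.
Variables (W : lmodType R) (f : A -> B -> W).
Hypothesis bf : bilinear_for *:%R *:%R f.
Lemma tlift_add x y : tlift_fun f (tadd x y) = tlift_fun f x + tlift_fun f y.
Proof. by rewrite tlift_pi// /tsum big_cat. Qed.
Lemma tlift_zero : tlift_fun f tzero = 0.
Proof. by rewrite tlift_pi// /tsum big_nil. Qed.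
Lemma tlift_scale a x : tlift_fun f (tscale a x) = a *: tlift_fun f x.
Proof.
rewrite tlift_pi// /tsum big_map scaler_sumr; apply: eq_bigr => p _ /=.
exact: (scalable_linear (bf.1 p.2)).
Qed.
End Lift.

Let tE W f bf := (@tlift_add W f bf, @tlift_zero W f bf, @tlift_scale W f bf).

Lemma taddA : associative tadd.
Proof. by move=> x y z; apply: tlift_inj => W f bf; rewrite !(tE bf) addrA. Qed.
Lemma taddC : commutative tadd.
Proof. by move=> x y; apply: tlift_inj => W f bf; rewrite !(tE bf) addrC. Qed.
Lemma tadd0 : left_id tzero tadd.
Proof. by move=> x; apply: tlift_inj => W f bf; rewrite !(tE bf) add0r. Qed.
Lemma taddN : left_inverse tzero topp tadd.
Proof.
by move=> x; apply: tlift_inj => W f bf; rewrite !(tE bf) scaleN1r addNr.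
Qed.
HB.instance Definition _ := GRing.isZmodule.Build tensor taddA taddC tadd0 taddN.

Lemma tscaleA a b x : tscale a (tscale b x) = tscale (a * b) x.
Proof. by apply: tlift_inj => W f bf; rewrite !(tE bf) scalerA. Qed.
Lemma tscale1 : left_id 1 tscale.
Proof. by move=> x; apply: tlift_inj => W f bf; rewrite !(tE bf) scale1r. Qed.
Lemma tscaleDr : right_distributive tscale +%R.
Proof.
by move=> a x y; apply: tlift_inj => W f bf; rewrite !(tE bf) scalerDr.
Qed.
Lemma tscaleDl x : {morph tscale^~ x : a b / a + b}.
Proof.
by move=> a b; apply: tlift_inj => W f bf; rewrite !(tE bf) scalerDl.
Qed.
HB.instance Definition _ := GRing.Zmodule_isLmodule.Build R tensor
  tscaleA tscale1 tscaleDr tscaleDl.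

Definition tens (a : A) (b : B) : tensor := \pi_tensor ([:: (a, b)] : fsum).

Lemma tlift_funE (W : lmodType R) (f : A -> B -> W) a b :
  bilinear_for *:%R *:%R f -> tlift_fun f (tens a b) = f a b.
Proof. by move=> bf; rewrite tlift_pi// /tsum big_seq1. Qed.

Lemma tens_bilinear : bilinear_for *:%R *:%R tens.
Proof.
split=> [b c a a'|a c b b']; apply: tlift_inj => W f bf;
  rewrite [RHS](tlift_add bf) (tlift_scale bf) !tlift_funE//.
  by rewrite bf.1.
by rewrite bf.2.
Qed.

Section LiftLinear.
Variables (W : lmodType R) (f : A -> B -> W).
Hypothesis bf : bilinear_for *:%R *:%R f.
Lemma tlift_linear : linear (tlift_fun f).
Proof. by move=> a x y; rewrite [LHS](tlift_add bf) (tlift_scale bf). Qed.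
Lemma tlift_subproof :
  {g : {linear tensor -> W} | forall a b, g (tens a b) = f a b}.
Proof.
pose g : {linear tensor -> W} :=
  HB.pack (tlift_fun f) (GRing.isLinear.Build _ _ _ _ _ tlift_linear).
by exists g => a b; apply: tlift_funE.
Qed.
Definition tlift : {linear tensor -> W} := sval tlift_subproof.
Lemma tliftE a b : tlift (tens a b) = f a b.
Proof. exact: (svalP tlift_subproof). Qed.
End LiftLinear.

Lemma tensor_sum (x : tensor) : x = \sum_(p <- repr x) tens p.1 p.2.
Proof.
apply: tlift_inj => W f bf; rewrite /tlift_fun {1}/tsum.
rewrite -/(tlift_fun f _) (big_morph _ (tlift_add bf) (tlift_zero bf)).
by apply: eq_bigr => p _; rewrite tlift_funE.
Qed.

Lemma tensor_ext (W : lmodType R) (f g : {linear tensor -> W}) :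
  (forall a b, f (tens a b) = g (tens a b)) -> f =1 g.
Proof.
move=> fg x; rewrite (tensor_sum x) !linear_sum.
by apply: eq_bigr => p _; apply: fg.
Qed.
End Tensor.

Notation "A \ox B" := (tensor A B) (at level 40, left associativity).

(* The symmetric monoidal structure of R-Vec; tassoci is the inverse of the
   associator tassoc. *)
Section TensorMaps.
Variable R : realType.
Implicit Types A B C : lmodType R.

Lemma bilinearP A B C (f : A -> B -> C) :
  (forall a, linear (f a)) -> (forall b, linear (f^~ b)) ->
  bilinear_for *:%R *:%R f.
Proof. by split. Qed.

Lemma tmap_bilinear A A' B B' (f : {linear A -> A'}) (g : {linear B -> B'}) :
  bilinear_for *:%R *:%R (fun a b => tens (f a) (g b)).
Proof.
by split=> [b c a a'|a c b b']; rewrite linearP ?(tens_bilinear _ _).1 ?(tens_bilinear _ _).2.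
Qed.
Definition tmap A A' B B' (f : {linear A -> A'}) (g : {linear B -> B'}) :
  {linear A \ox B -> A' \ox B'} := tlift (tmap_bilinear f g).

Lemma tsym_bilinear A B : bilinear_for *:%R *:%R (fun (a : A) (b : B) => tens b a).
Proof.
by split=> [b c a a'|a c b b']; rewrite ?(tens_bilinear _ _).1 ?(tens_bilinear _ _).2.
Qed.
Definition tsym A B : {linear A \ox B -> B \ox A} := tlift (@tsym_bilinear A B).

Lemma tassoc1_bilinear A B C (c : C) :
  bilinear_for *:%R *:%R (fun (a : A) (b : B) => tens a (tens b c)).
Proof.
by split=> [b r a a'|a r b b']; rewrite ?(tens_bilinear _ _).1 ?(tens_bilinear _ _).2.
Qed.
Lemma tassoc_bilinear A B C :
  bilinear_for *:%R *:%R (fun (x : A \ox B) (c : C) => tlift (@tassoc1_bilinear A B C c) x).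
Proof.
split=> [c|x r c c']; first exact: linearP.
pose L d := tlift (@tassoc1_bilinear A B C d).
apply: (@tensor_ext _ _ _ _ (L _) (r \*: L c \+ L c')) => a b; rewrite /L /=.
by rewrite !tliftE !(tens_bilinear _ _).2.
Qed.
Definition tassoc A B C : {linear (A \ox B) \ox C -> A \ox (B \ox C)} :=
  tlift (@tassoc_bilinear A B C).

Lemma tassoci1_bilinear A B C (a : A) :
  bilinear_for *:%R *:%R (fun (b : B) (c : C) => tens (tens a b) c).
Proof.
by split=> [c r b b'|b r c c']; rewrite ?(tens_bilinear _ _).2 ?(tens_bilinear _ _).1.
Qed.
Lemma tassoci_bilinear A B C :
  bilinear_for *:%R *:%R (fun (a : A) (x : B \ox C) => tlift (@tassoci1_bilinear A B C a) x).
Proof.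
split=> [x r a a'|a]; last exact: linearP.
pose L d := tlift (@tassoci1_bilinear A B C d).
apply: (@tensor_ext _ _ _ _ (L _) (r \*: L a \+ L a')) => b c; rewrite /L /=.
by rewrite !tliftE !(tens_bilinear _ _).1.
Qed.
Definition tassoci A B C : {linear A \ox (B \ox C) -> (A \ox B) \ox C} :=
  tlift (@tassoci_bilinear A B C).

Lemma tunitl_bilinear A :
  bilinear_for *:%R *:%R (fun (r : R^o) (a : A) => r *: a).
Proof.
split=> [a r s t|r s a b]; first by rewrite /= scalerDl scalerA.
by rewrite /= scalerDr !scalerA mulrC.
Qed.
Definition tunitl A : {linear R^o \ox A -> A} := tlift (@tunitl_bilinear A).

Lemma tmapE A A' B B' (f : {linear A -> A'}) (g : {linear B -> B'}) a b :
  tmap f g (tens a b) = tens (f a) (g b).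
Proof. exact: tliftE. Qed.
Lemma tsymE A B (a : A) (b : B) : tsym A B (tens a b) = tens b a.
Proof. exact: tliftE. Qed.
Lemma tassocE A B C (a : A) (b : B) (c : C) :
  tassoc A B C (tens (tens a b) c) = tens a (tens b c).
Proof. by rewrite /tassoc !tliftE. Qed.
Lemma tassociE A B C (a : A) (b : B) (c : C) :
  tassoci A B C (tens a (tens b c)) = tens (tens a b) c.
Proof. by rewrite /tassoci !tliftE. Qed.
Lemma tunitlE A (r : R^o) (a : A) : tunitl A (tens r a) = r *: a.
Proof. exact: tliftE. Qed.
End TensorMaps.

(* Algebra modalities and integral transformations on R-Vec, as equations
   between linear maps.  Note that \o is composition in applicative order. *)
Section CoIntegral.
Variable R : realType.

Record modality_data := ModalityData {
  mod_obj :> lmodType R -> lmodType R;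
  mod_map : forall A B : lmodType R,
    {linear A -> B} -> {linear mod_obj A -> mod_obj B};
  mod_mu : forall A : lmodType R, {linear mod_obj (mod_obj A) -> mod_obj A};
  mod_eta : forall A : lmodType R, {linear A -> mod_obj A};
  mod_mul : forall A : lmodType R, {linear mod_obj A \ox mod_obj A -> mod_obj A};
  mod_unit : forall A : lmodType R, {linear R^o -> mod_obj A} }.

Variable S : modality_data.
Local Notation mu := (mod_mu S).
Local Notation eta := (mod_eta S).
Local Notation m := (mod_mul S).
Local Notation u := (mod_unit S).

Record algebra_modality : Prop := AlgebraModality {
  am_map_id : forall A : lmodType R, mod_map S (idfun : {linear A -> A}) =1 idfun;
  am_map_comp : forall (A B C : lmodType R) (f : {linear A -> B}) (g : {linear B -> C}),
    mod_map S (g \o f) =1 mod_map S g \o mod_map S f;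
  am_mu_natural : forall (A B : lmodType R) (h : {linear A -> B}),
    mu B \o mod_map S (mod_map S h) =1 mod_map S h \o mu A;
  am_eta_natural : forall (A B : lmodType R) (h : {linear A -> B}),
    eta B \o h =1 mod_map S h \o eta A;
  am_mu_etal : forall A : lmodType R, mu A \o eta (S A) =1 idfun;
  am_mu_etar : forall A : lmodType R, mu A \o mod_map S (eta A) =1 idfun;
  am_mu_mu : forall A : lmodType R, mu A \o mu (S A) =1 mu A \o mod_map S (mu A);
  am_mul_natural : forall (A B : lmodType R) (h : {linear A -> B}),
    m B \o tmap (mod_map S h) (mod_map S h) =1 mod_map S h \o m A;
  am_unit_natural : forall (A B : lmodType R) (h : {linear A -> B}),
    u B =1 mod_map S h \o u A;
  am_mulA : forall A : lmodType R,
    m A \o tmap (m A) idfun =1 m A \o tmap idfun (m A) \o @tassoc R _ _ _;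
  am_mulC : forall A : lmodType R, m A \o @tsym R _ _ =1 m A;
  am_mul1 : forall A : lmodType R, m A \o tmap (u A) idfun =1 @tunitl R _;
  am_mu_mul : forall A : lmodType R, mu A \o m (S A) =1 m A \o tmap (mu A) (mu A);
  am_mu_unit : forall A : lmodType R, mu A \o u (S A) =1 u A }.

Variable s : forall A : lmodType R, {linear S A \ox A -> S A}.

(* it_unit, it_rota_baxter and it_interchange are the axioms [s.1], [s.2] and
   [s.3], with the associators and the left unitor made explicit. *)
Record integral_transformation : Prop := IntegralTransformation {
  it_natural : forall (A B : lmodType R) (h : {linear A -> B}),
    s B \o tmap (mod_map S h) h =1 mod_map S h \o s A;
  it_unit : forall A : lmodType R, s A \o tmap (u A) idfun =1 eta A \o @tunitl R A;
  it_rota_baxter : forall A : lmodType R,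
    m A \o tmap (s A) (s A) =1
      (s A \o tmap (m A) idfun \o @tassoci R (S A) (S A) A
         \o tmap (s A) (idfun : {linear S A \ox A -> S A \ox A}))
      \+
      (s A \o tmap (m A) idfun \o @tassoci R (S A) (S A) A
         \o tmap idfun (@tsym R A (S A)) \o @tassoc R (S A) A (S A)
         \o tmap (idfun : {linear S A \ox A -> S A \ox A}) (s A));
  it_interchange : forall A : lmodType R,
    s A \o tmap (s A) idfun =1
      s A \o tmap (s A) idfun \o @tassoci R (S A) A A
        \o tmap idfun (@tsym R A A) \o @tassoc R (S A) A A }.

Definition co_integral : Prop := algebra_modality /\ integral_transformation.
End CoIntegral.

Section FreeModality.
Variable R : realType.
Implicit Types V W : lmodType R.

Lemma cr_mul_bilinear (X : cinfRing R) :
  bilinear_for *:%R *:%R (fun x y : X => x * y).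
Proof.
split=> [y a x x'|x a y y'] /=; first by rewrite mulrDl cr_scalerAl.
by rewrite mulrDr mulrC -cr_scalerAl mulrC.
Qed.
Definition Sinf_mul V : {linear Sinf V \ox Sinf V -> Sinf V} :=
  tlift (cr_mul_bilinear (Sinf V)).

Lemma Sinf_mulE V (x y : Sinf V) : Sinf_mul V (tens x y) = x * y.
Proof. exact: tliftE. Qed.

Lemma Sinf_unit_linear V : linear (fun r : R^o => r *: (1 : Sinf V)).
Proof. by move=> a r t; rewrite scalerDl scalerA. Qed.
Definition Sinf_unit V : {linear R^o -> Sinf V} :=
  HB.pack (fun r : R^o => r *: (1 : Sinf V))
    (GRing.isLinear.Build _ _ _ _ _ (@Sinf_unit_linear V)).

Definition Sinf_modality : modality_data R :=
  @ModalityData R (fun V => Sinf V) (@Sinf_map R) (@Sinf_mu R) (@Sinf_eta R)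
    Sinf_mul Sinf_unit.

(* The 1-form \sum_i w_i dx_i; by one_form_bij every element of
   C^oo(R^n) (x) R^n is of this form for a unique w. *)
Definition one_form n (w : 'I_n -> Cinf R n) :
    Sinf 'rV[R]_n \ox 'rV[R]_n :=
  \sum_i tens (Sinf_of_Cinf (w i)) 'e_i.

Lemma sum_deltaZ (W : lmodType R) n (x : 'I_n -> W) i :
  \sum_j ('e_j : 'rV[R]_n) 0 i *: x j = x i.
Proof.
rewrite (bigD1 i)//= mxE !eqxx scale1r big1 ?addr0// => j /negPf ji.
by rewrite mxE eqxx eq_sym ji scale0r.
Qed.

Lemma one_form_bij n : bijective (@one_form n).
Proof.
pose c (i : 'I_n) (x : Sinf 'rV[R]_n) (v : 'rV[R]_n) := v 0 i *: x.
have bc i : bilinear_for *:%R *:%R (c i).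
  split=> [v a x y|x a v w]; rewrite /c /=; last by rewrite !mxE scalerDl scalerA.
  by rewrite scalerDr !scalerA mulrC.
pose g z (i : 'I_n) : Cinf R n := Cinf_of_Sinf R n (tlift (bc i) z).
exists g => [w|z].
  apply/funext => i; rewrite /g.
  suff -> : tlift (bc i) (one_form w) = Sinf_of_Cinf (w i).
    exact: Sinf_of_CinfK.
  rewrite /one_form linear_sum -[RHS](sum_deltaZ (fun j => Sinf_of_Cinf (w j)) i).
  by apply: eq_bigr => j _; rewrite tliftE.
rewrite [RHS]tensor_sum /one_form /g.
under eq_bigr => i _ do rewrite Cinf_of_SinfK {1}[z]tensor_sum linear_sum.
transitivity (\sum_i \sum_(p <- repr z) p.2 0 i *: tens p.1 ('e_i : 'rV[R]_n)).
  apply: eq_bigr => i _.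
  pose T : {linear Sinf 'rV[R]_n -> Sinf 'rV[R]_n \ox 'rV[R]_n} :=
    HB.pack (fun x : Sinf 'rV[R]_n => tens x ('e_i : 'rV[R]_n))
     (GRing.isLinear.Build _ _ _ _ _ ((tens_bilinear _ _).1 ('e_i : 'rV[R]_n))).
  rewrite -[LHS]/(T _) linear_sum; apply: eq_bigr => p _.
  by rewrite tliftE /c linearZ.
rewrite exchange_big; apply: eq_bigr => p _ /=.
pose T : {linear 'rV[R]_n -> Sinf 'rV[R]_n \ox 'rV[R]_n} :=
  HB.pack (fun v : 'rV[R]_n => tens p.1 v)
    (GRing.isLinear.Build _ _ _ _ _ ((tens_bilinear _ _).2 p.1)).
rewrite -[RHS]/(T _) [in RHS](row_sum_delta p.2) linear_sum.
by apply: eq_bigr => i _; rewrite linearZ.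
Qed.

Record is_deriving (d : forall V, {linear Sinf V -> Sinf V \ox V}) : Prop :=
  IsDeriving {
    deriving_natural : forall V W (h : {linear V -> W}),
      d W \o Sinf_map h =1 tmap (Sinf_map h) h \o d V;
    deriving_Cinf : forall n (f : Cinf R n),
      d 'rV[R]_n (Sinf_of_Cinf f) = one_form (Cinf_partial f) }.

Definition coderiving V : {linear Sinf V \ox V -> Sinf V} :=
  Sinf_mul V \o tmap idfun (Sinf_eta V).

(* K = d d^o + S^oo(0) (diagrammatic order) *)
Definition Kmap (d : forall V, {linear Sinf V -> Sinf V \ox V}) V :
    {linear Sinf V -> Sinf V} :=
  (coderiving V \o d V) \+ Sinf_map (\0 : {linear V -> V}).

(* The integral of \sum_i w_i dx_i along the curve c : [0, 1] -> R^n. *)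
Definition line_integral n (w : 'I_n -> Cinf R n) (c : R -> 'rV[R]_n) : R :=
  \int[lebesgue_measure]_(t in `[0, 1]) (\sum_i w i (c t) * ('D_1 c t) 0 i).

Definition segment n (v : 'rV[R]_n) (t : R) : 'rV[R]_n := t *: v.
End FreeModality.

(* Main.v *)
Require Import Defs.
From HB Require Import structures.
From mathcomp Require Import all_boot all_order all_algebra ring.
From mathcomp Require Import all_classical all_reals all_analysis.

(** Write d for the derivation, d^o for the map x (x) v |-> x v, and
    E = d^o d for the induced derivation of the ring S^oo(V); on C^oo(R^n) it is
    the Euler operator sum_i x_i d/dx_i, and K = E + S^oo(0).  Every element of
    S^oo(V) is a smooth function of finitely many vectors of V, so statements on
    S^oo(V) reduce to statements on C^oo(R^n).  Two analytic facts are needed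
    there: E + 1 is inverted by the radial mean f |-> (x |-> int_0^1 f(tx) dt),
    and K f = 0 forces f to be constant along rays, hence zero.  The second fact
    gives injectivity of K on S^oo(V) because linear maps R^n -> V have
    generalized inverses; the first one and Hadamard's lemma give surjectivity.
    The element z = s(w) is then characterized by E z = d^o w and S^oo(0) z = 0,
    from which the Rota-Baxter rule follows because E is a derivation, and
    s(x (x) v) = v (E + 1)^-1 x, which gives the interchange rule and, on R^n,
    the line integral. *)

Set Implicit Arguments.
Unset Strict Implicit.
Unset Printing Implicit Defensive.
Import Order.TTheory GRing.Theory Num.Theory numFieldNormedType.Exports.
Local Open Scope ring_scope.

(** * Radial means of smooth functions *)

Section RadialMean.
Local Open Scope classical_set_scope.
Variables (R : realType) (n : nat).
Implicit Types (f w : 'rV[R]_n -> R) (x h : 'rV[R]_n).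
Local Notation mu := (@lebesgue_measure R).

Lemma derive_partials f x h : differentiable f x ->
  'D_h f x = \sum_i h 0 i * 'D_'e_i f x.
Proof.
move=> df; rewrite deriveE// [h in LHS]row_sum_delta linear_sum.
by apply: eq_bigr => i _; rewrite linearZ/= -deriveE.
Qed.

(** The form [h |-> \sum_i h 0 i * a i] is linear and continuous, and the estimate is the little-o
    condition, so uniqueness of the differential identifies it with ['d f x]. Differentiability and
    the values of the partial derivatives then come from a single estimate. *)
Lemma differentiable_littleo f x (a : 'I_n -> R) :
  (forall e, 0 < e -> \forall h \near (0 : 'rV[R]_n),
     `|f (h + x) - f x - \sum_i h 0 i * a i| <= e * `|h|) ->
  differentiable f x /\ forall i, 'D_'e_i f x = a i.
Proof.
move=> fa; pose L h := \sum_i h 0 i * a i.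
have linL : linear L.
  move=> r u v; rewrite /L scaler_sumr -big_split; apply: eq_bigr => i _ /=.
  by rewrite !mxE mulrDl -mulrA.
pose l : {linear 'rV[R]_n -> R} :=
  HB.pack L (GRing.isLinear.Build _ _ _ _ _ linL).
have cl : continuous l.
  move=> y; apply: differentiable_continuous.
  rewrite (_ : (l : _ -> R) = \sum_i (fun h : 'rV[R]_n => h 0 i * a i)).
    apply: differentiable_sum => i; apply: differentiableM => //.
    exact: differentiable_coord.
  by apply/funext => h; rewrite fct_sumE.
have fl e : 0 < e -> \forall h \near (0 : 'rV[R]_n),
    `|(f \o shift x - (cst (f x) + l)) h| <= e * `|h|.
  move=> /fa; apply: filterS => h.
  by rewrite -[(_ - _) h]/(f (h + x) - (f x + L h)) opprD addrA.
have dl : 'd f x = l :> ('rV[R]_n -> R) by apply: diff_unique => //; apply/eqaddoP.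
have df : differentiable f x.
  by apply/diff_locallyP; rewrite dl; split=> //; apply/eqaddoP.
split=> // i; rewrite deriveE// dl /= /L (bigD1 i)//= mxE !eqxx mul1r.
by rewrite big1 ?addr0// => j /negPf ji; rewrite mxE ji mul0r.
Qed.

(** The difference quotient of the restriction to the line is the quotient of [f] in direction [h]
    at [t *: h + x], so both derivatives are the same limit. *)
Lemma is_derive_line f x h (t : R) :
  (forall y, differentiable f y) ->
  is_derive t 1 (fun t => f (t *: h + x)) ('D_h f (t *: h + x)).
Proof.
move=> df; pose quot s := s^-1 *: ((f \o shift (t *: h + x)) (s *: h) - f (t *: h + x)).
have quotE : (fun s : R => s^-1 *: (((fun t : R => f (t *: h + x)) \o shift t) (s *: 1)
    - f (t *: h + x))) = quot.
  apply/funext => s; rewrite /quot /=.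
  by rewrite [s *: 1 : R]mulr1 scalerDl addrA.
apply: DeriveDef.
  rewrite /derivable (_ : (fun s => _) = quot); first exact: diff_derivable.
  exact: quotE.
by rewrite /derive quotE.
Qed.

Lemma MVT_line f x h : (forall y, differentiable f y) ->
  exists2 s : R, 0 <= s <= 1 & f (h + x) - f x = 'D_h f (s *: h + x).
Proof.
move=> df.
have d (s : R) : is_derive s 1 (fun s : R => f (s *: h + x)) ('D_h f (s *: h + x)).
  exact: is_derive_line.
have c : {within `[0, 1], continuous (fun s : R => f (s *: h + x))}.
  apply: continuous_subspaceT => s.
  apply/differentiable_continuous/derivable1_diffP.
  by have [] := d s.
have [s] := MVT_segment (@ler01 R) (fun s _ => d s) c.
rewrite in_itv /= => s01; rewrite subr0 mulr1 scale1r scale0r add0r => E.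
by exists s.
Qed.

(** The weight [t ^+ k] makes the family stable under partial derivatives: differentiating
    [w (t *: x)] in [x] brings out one more factor [t]. *)
Definition radial_mean k w x : R := \int[mu]_(t in `[0, 1]) (t ^+ k * w (t *: x)).

Lemma scale_pair_continuous (p : R * 'rV[R]_n) :
  (fun q : R * 'rV[R]_n => q.1 *: q.2) @ p --> p.1 *: p.2.
Proof. by apply: cvgZ; [exact: cvg_fst|exact: cvg_snd]. Qed.

Lemma radial_continuous k w x : continuous w ->
  continuous (fun t : R => t ^+ k * w (t *: x)).
Proof.
move=> cw t; apply: cvgM; first exact: exprn_continuous.
apply: (@cvg_comp _ _ _ (fun t : R => t *: x) w); last exact: cw.
by apply: cvgZr_tmp; exact: cvg_id.
Qed.

Lemma continuous_integrable01 (g : R -> R) : continuous g ->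
  mu.-integrable `[0, 1] (EFin \o g).
Proof.
move=> cg; apply: continuous_compact_integrable; first exact: segment_compact.
exact: continuous_subspaceT.
Qed.

(** Joint continuity of [(t, y) |-> w (t *: y)] gives a neighbourhood of [x] for each [t];
    compactness of [[0, 1]] makes it uniform in [t]. *)
Lemma radial_uniform w x (e : R) : continuous w -> 0 < e ->
  \forall y \near x, forall t : R, 0 <= t <= 1 -> `|w (t *: y) - w (t *: x)| <= e.
Proof.
move=> cw e0.
have /compact_near_coveringP cpt := @segment_compact R 0 1.
have cwx (t : R) : \forall p \near (t, x), `|w (t *: x) - w (p.1 *: p.2)| <= e / 2.
  have /= := @cvg_comp _ _ _ (fun q : R * 'rV[R]_n => q.1 *: q.2) w _ _ _
    (@scale_pair_continuous (t, x)) (cw (t *: x)).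
  by move/cvgrPdist_le; apply; rewrite divr_gt0.
have := cpt _ (nbhs x) (fun y t => 0 <= t <= 1 -> `|w (t *: y) - w (t *: x)| <= e) _.
move=> H; suff K : \forall y \near x, `[0, 1] `<=`
    (fun t : R => 0 <= t <= 1 -> `|w (t *: y) - w (t *: x)| <= e).
  by near=> y => t t01; apply: (near K y) => //; rewrite /= in_itv.
apply: H => t _; have cx := cwx t.
(* The term [w (p.1 *: x)] also moves with [p.1], so both terms are compared with [w (t *: x)], each
   up to [e / 2]. *)
have cx' : \forall p \near (t, x), `|w (t *: x) - w (p.1 *: x)| <= e / 2.
  have cwt : (fun s : R => w (s *: x)) @ t --> w (t *: x).
    apply: (@cvg_comp _ _ _ (fun s : R => s *: x) w); last exact: (cw (t *: x)).
    by apply: cvgZr_tmp; exact: cvg_id.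
  move/cvgrPdist_le : cwt => /(_ (e / 2)); rewrite divr_gt0// => /(_ isT) Hs.
  exact: (cvg_fst Hs).
near=> p => _; rewrite [e]splitr.
rewrite (_ : w (p.1 *: p.2) - _ = (w (t *: x) - w (p.1 *: x)) - (w (t *: x) - w (p.1 *: p.2))).
  by apply: le_trans (ler_normB _ _) _; apply: lerD; near: p.
by ring.
Unshelve. all: by end_near.
Qed.

Lemma ler_norm_coord h i : `|h 0 i| <= `|h|.
Proof.
rewrite [`|h|]mx_normrE.
exact: (le_bigmax 0 (fun ij : 'I_1 * 'I_n => `|h ij.1 ij.2|) (0, i)).
Qed.

Lemma Rintegral01_sum m (F : 'I_m -> R -> R) : (forall i, continuous (F i)) ->
  \int[mu]_(t in `[0, 1]) (\sum_i F i t) = \sum_i \int[mu]_(t in `[0, 1]) F i t.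
Proof.
elim: m F => [|m IH] F cF.
  under eq_Rintegral do rewrite big_ord0.
  by rewrite big_ord0 Rintegral_cst// mul0r.
under eq_Rintegral do rewrite big_ord_recr.
rewrite RintegralD// ?IH ?big_ord_recr//; last exact: continuous_integrable01.
apply: continuous_integrable01.
by apply: continuous_big => //; exact: add_continuous.
Qed.

(** Differentiation under the integral sign: the mean value theorem turns the first-order remainder
    of the integrand into increments of the partial derivatives, which are small uniformly in
    [t]. *)
Lemma radial_mean_differentiable k w x : smooth w ->
  differentiable (radial_mean k w) x /\
  forall i, 'D_'e_i (radial_mean k w) x = radial_mean k.+1 ('D_'e_i w) x.
Proof.
move=> sw.
have dw y : differentiable w y by have [] := sw 1%N.
have dD i y : differentiable ('D_'e_i w) y by have [_ /(_ i) []] := sw 2%N.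
have cw : continuous w by move=> y; exact: differentiable_continuous.
have cD i : continuous ('D_'e_i w) by move=> y; exact: differentiable_continuous.
apply: differentiable_littleo => e e0.
(* The [n] coordinates contribute at most [e'] times the norm of [h] each; dividing by [n.+1] also
   covers [n = 0]. *)
pose e' := e / n.+1%:R.
have e'0 : 0 < e' by rewrite divr_gt0.
have : \forall y \near x, forall i (t : R), 0 <= t <= 1 ->
    `|'D_'e_i w (t *: y) - 'D_'e_i w (t *: x)| <= e'.
  apply: (@filter_forall _ 'I_n (fun i y => forall t : R, 0 <= t <= 1 ->
    `|'D_'e_i w (t *: y) - 'D_'e_i w (t *: x)| <= e') (nbhs x)) => i.
  exact: radial_uniform (cD i) e'0.
move=> /nbhs_ballP[d /= d0 Hd].
near=> h.
have hd : `|h| < d by near: h; apply: (@nbhs0_lt R 'rV[R]_n).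
pose g t := t ^+ k * w (t *: (h + x)) - t ^+ k * w (t *: x)
  - \sum_i h 0 i * (t ^+ k.+1 * 'D_'e_i w (t *: x)).
have cg1 y : continuous (fun t : R => t ^+ k * w (t *: y)) by exact: radial_continuous.
have cg2 i : continuous (fun t : R => t ^+ k.+1 * 'D_'e_i w (t *: x)).
  exact: (@radial_continuous _ ('D_'e_i w) x (cD i)).
have cg3 i : continuous (fun t : R => h 0 i * (t ^+ k.+1 * 'D_'e_i w (t *: x))).
  by move=> t; apply: cvgM; [exact: cvg_cst|exact: cg2].
have cg4 : continuous (fun t : R => t ^+ k * w (t *: (h + x)) - t ^+ k * w (t *: x)).
  by move=> t; apply: cvgB; exact: cg1.
have cg5 : continuous (fun t : R => \sum_i h 0 i * (t ^+ k.+1 * 'D_'e_i w (t *: x))).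
  by apply: continuous_big => //; exact: add_continuous.
have cg : continuous g by move=> t; apply: cvgB; [exact: cg4|exact: cg5].
have -> : radial_mean k w (h + x) - radial_mean k w x -
    \sum_i h 0 i * radial_mean k.+1 ('D_'e_i w) x = \int[mu]_(t in `[0, 1]) g t.
  rewrite /g RintegralB//; [|exact: continuous_integrable01..].
  rewrite RintegralB//; [|exact: continuous_integrable01..].
  rewrite Rintegral01_sum//; congr (_ - _).
  by apply: eq_bigr => i _; rewrite RintegralZl//; exact: continuous_integrable01.
apply: le_trans (le_normr_Rintegral _ _) _ => //; first exact: continuous_integrable01.
have -> : e * `|h| = \int[mu]_(t in `[0, 1]) (e * `|h|).
  by rewrite Rintegral_cst//= lebesgue_measure_itv/= lte01 sube0 mulr1.
apply: le_Rintegral => //; [|apply: continuous_integrable01; exact: cst_continuous|].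
  apply: continuous_integrable01 => t; apply: cvg_norm; exact: cg.
move=> t; rewrite /= in_itv /= => /andP[t0 t1].
(* The intermediate point is [t *: (s *: h + x)], with [s *: h + x] in the ball of radius [d] around
   [x], where [Hd] applies. *)
have [s /andP[s0 s1] E] := MVT_line (t *: x) (t *: h) dw.
have {E} -> : g t = \sum_i t ^+ k.+1 * h 0 i *
    ('D_'e_i w (t *: (s *: h + x)) - 'D_'e_i w (t *: x)).
  rewrite /g -mulrBr scalerDr E derive_partials// mulr_sumr -sumrB.
  apply: eq_bigr => i _; rewrite mxE !scalerDr !scalerA [s * t]mulrC.
  by rewrite exprSr; ring.
apply: le_trans (ler_norm_sum _ _ _) _.
apply: (@le_trans _ _ (\sum_(i < n) `|h| * e')); last first.
  rewrite sumr_const card_ord -mulr_natr.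
  rewrite (_ : _ * n%:R = (e * `|h|) * (n%:R / n.+1%:R)); last by rewrite /e'; ring.
  apply: ler_piMr; first by rewrite mulr_ge0// ltW.
  by rewrite ler_pdivrMr// mul1r ler_nat leqnSn.
apply: ler_sum => i _; rewrite !normrM; apply: ler_pM => //.
- rewrite -[leRHS]mul1r ler_pM ?ler_norm_coord// normrX ger0_norm//.
  by rewrite exprn_ile1.
- apply: Hd; last by rewrite t0.
  rewrite -ball_normE /= opprD addrC -addrA addNr addr0 normrN normrZ.
  rewrite ger0_norm//; apply: le_lt_trans hd.
  by rewrite ler_piMl.
Unshelve. all: by end_near.
Qed.

Lemma radial_mean_smooth k w : smooth w -> smooth (radial_mean k w).
Proof.
move=> + m; elim: m k w => [//|m IH] k w sw; split=> [x|i].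
  by have [] := radial_mean_differentiable k x sw.
rewrite (_ : 'D_ _ _ = radial_mean k.+1 ('D_'e_i w)).
  by apply: IH => p; have [_] := sw p.+1; apply.
by apply/funext => x; have [_ ->] := radial_mean_differentiable k x sw.
Qed.

Lemma is_derive_ray w x (t : R) : (forall y, differentiable w y) ->
  is_derive t 1 (fun t => w (t *: x)) (\sum_i x 0 i * 'D_'e_i w (t *: x)).
Proof.
move=> dw; have := is_derive_line 0 x t dw.
rewrite derive_partials// addr0.
by rewrite (_ : (fun t => w (t *: x + 0)) = (fun t => w (t *: x)))//;
  apply/funext => s; rewrite addr0.
Qed.

(* The integrand below is the derivative of t w(tx). *)
Lemma radial_mean_euler w x : smooth w ->
  radial_mean 0 w x + \sum_i x 0 i * 'D_'e_i (radial_mean 0 w) x = w x.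
Proof.
move=> sw.
have dw y : differentiable w y by have [] := sw 1%N.
have dD i y : differentiable ('D_'e_i w) y by have [_ /(_ i) []] := sw 2%N.
have cw : continuous w by move=> y; exact: differentiable_continuous.
have cD i : continuous ('D_'e_i w) by move=> y; exact: differentiable_continuous.
have cg1 : continuous (fun t : R => t ^+ 0 * w (t *: x)) by exact: radial_continuous.
have cg2 i : continuous (fun t : R => t ^+ 1 * 'D_'e_i w (t *: x)).
  exact: (@radial_continuous _ ('D_'e_i w) x (cD i)).
have cg3 i : continuous (fun t : R => x 0 i * (t ^+ 1 * 'D_'e_i w (t *: x))).
  by move=> t; apply: cvgM; [exact: cvg_cst|exact: cg2].
have cg4 : continuous (fun t : R => \sum_i x 0 i * (t ^+ 1 * 'D_'e_i w (t *: x))).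
  by apply: continuous_big => //; exact: add_continuous.
pose g t := t ^+ 0 * w (t *: x) + \sum_i x 0 i * (t ^+ 1 * 'D_'e_i w (t *: x)).
have cg : continuous g by move=> t; apply: cvgD; [exact: cg1|exact: cg4].
have -> : radial_mean 0 w x + \sum_i x 0 i * 'D_'e_i (radial_mean 0 w) x =
    \int[mu]_(t in `[0, 1]) g t.
  rewrite /g RintegralD//; [|exact: continuous_integrable01..].
  rewrite Rintegral01_sum//; congr (_ + _).
  apply: eq_bigr => i _; have [_ ->] := radial_mean_differentiable 0 x sw.
  by rewrite RintegralZl//; exact: continuous_integrable01.
pose G (t : R) := t * w (t *: x).
have dG (t : R) : is_derive t 1 G (g t).
  have dr := is_derive_ray x t dw.
  have -> : G = (id : R -> R) * (fun t => w (t *: x)) by [].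
  apply: is_derive_eq; rewrite /g expr0 mul1r expr1 addrC; congr (_ + _).
    by rewrite [LHS]mulr1.
  by rewrite scaler_sumr; apply: eq_bigr => i _; rewrite mulrCA.
have cG : continuous G.
  move=> t; apply/differentiable_continuous/derivable1_diffP.
  by have [] := dG t.
rewrite /Rintegral (@continuous_FTC2 _ g G)//.
- by rewrite /G /= !scale0r scale1r mul0r subr0 mul1r.
- exact: continuous_subspaceT.
- split=> [t _||]; first by have [] := dG t.
  + by apply: cvg_at_right_filter; exact: cG.
  + by apply: cvg_at_left_filter; exact: cG.
- by move=> t _; rewrite derive1E; have [] := dG t.
Qed.

(** At [y = 0] the hypothesis gives [w 0 = 0]. At [t *: x] it then says that [t] times the
    derivative of [w] along the ray vanishes, so [w x = w 0] by the mean value theorem. *)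
Lemma euler_eq0 w x : smooth w ->
  (forall y : 'rV[R]_n, w 0 + \sum_i y 0 i * 'D_'e_i w y = 0) -> w x = 0.
Proof.
move=> sw H.
have w0 : w 0 = 0.
  have := H 0; rewrite big1 ?addr0// => i _; by rewrite mxE mul0r.
have dw y : differentiable w y by have [] := sw 1%N.
pose g (t : R) := w (t *: x).
have dg (t : R) : is_derive t 1 g (\sum_i x 0 i * 'D_'e_i w (t *: x)).
  exact: is_derive_ray.
have cg : {within `[0, 1], continuous g}.
  apply: continuous_subspaceT => t; apply/differentiable_continuous/derivable1_diffP.
  by have [] := dg t.
(* The intermediate point is interior; [0 < t] allows the factor [t] to be cancelled below. *)
have [t] := MVT (@ltr01 R) (fun t _ => dg t) cg.
rewrite in_itv /= => /andP[t0 _].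
rewrite /g scale1r scale0r w0 subr0 subr0 mulr1 => ->.
have := H (t *: x); rewrite w0 add0r.
rewrite (eq_bigr (fun i => t * (x 0 i * 'D_'e_i w (t *: x)))); last first.
  by move=> i _; rewrite mxE mulrA.
by move/eqP; rewrite -mulr_sumr mulf_eq0 gt_eqF//= => /eqP.
Qed.
End RadialMean.

(** * Generalized inverses of linear maps *)

Section GeneralizedInverse.
Local Open Scope classical_set_scope.
Variables (K : fieldType) (U V : lmodType K).

(** Zorn's lemma provides a maximal graph satisfying [P]; maximality forces its domain to be all of
    [V]. The spaces may have infinite dimension. *)
Lemma linear_generalized_inverse (h : {linear U -> V}) :
  exists g : {linear V -> U}, forall u, h (g (h u)) = h u.
Proof.
(* G is the graph of a partial linear map V -> U, and the last condition lets it
   be extended to im h. *)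
pose P (G : set (V * U)) := [/\ forall a p q, G p -> G q -> G (a *: p + q),
  forall u, G (0, u) -> u = 0 &
  forall p u, G p -> p.1 = h u -> h p.2 = h u].
have [G [[lG fG hG] maxG]] : exists G, P G /\ forall G', G `<` G' -> ~ P G'.
  apply: Zorn_bigcup => F FP Ftot; split.
  - move=> a p q [X FX Xp] [Y FY Yq].
    have [XY|YX] := Ftot _ _ FX FY.
      by exists Y => //; have [+ _ _] := FP _ FY; apply => //; apply: XY.
    by exists X => //; have [+ _ _] := FP _ FX; apply => //; apply: YX.
  - by move=> u [X /FP[_ + _] Xu]; apply.
  - by move=> p u [X /FP[_ _ +] Xp]; apply.
(* The union of an empty chain is empty, so [P] must admit the empty set and [0] in [G] comes from
   maximality: a [G] without [0] is empty, and [[set 0]] would extend it. *)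
have G0 : G 0.
  apply: contrapT => nG0.
  have nG p : ~ G p by move=> Gp; apply: nG0; rewrite -(addNr p) -scaleN1r; exact: lG.
  apply: (maxG [set 0]).
    by split=> [p /nG//|] /(_ _ erefl).
  split=> [a _ _ -> ->|u [] //|p u -> /= <-]; first by rewrite scaler0 addr0.
  by rewrite linear0.
(* One-dimensional extension: if [x0] were outside the domain, adjoining the line through [(x0, u0)]
   would contradict maximality. The premise keeps the third clause of [P]. *)
have ext x0 u0 : (forall r p u, G p -> p.1 + r *: x0 = h u -> h (p.2 + r *: u0) = h u) ->
    exists u, G (x0, u).
  move=> H; apply: contrapT => nx0.
  apply: (maxG [set q | exists r p, G p /\ q = p + r *: (x0, u0)]).
    split=> [p Gp|]; first by exists 0, p; rewrite scale0r addr0.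
    move=> /(_ (x0, u0)) Gx; apply: nx0; exists u0; apply: Gx.
    by exists 1, 0; rewrite scale1r add0r.
  split.
  - move=> a _ _ [r [p [Gp ->]]] [r' [p' [Gp' ->]]].
    exists (a * r + r'), (a *: p + p'); split; first exact: lG.
    by rewrite scalerDl -scalerA scalerDr addrACA.
  - move=> u [r [[p1 p2] [Gp [/= E1 E2]]]].
    have [r0|r0] := eqVneq r 0.
      rewrite r0 !scale0r !addr0 in E1 E2.
      by rewrite E2; apply: fG; rewrite E1.
    case: nx0; exists (- r^-1 *: p2).
    suff -> : (x0, - r^-1 *: p2) = - r^-1 *: (p1, p2) + 0 by apply: lG.
    rewrite addr0; congr pair.
    move/eqP: E1; rewrite eq_sym addr_eq0 => /eqP ->.
    by rewrite scaleNr scalerN opprK scalerA mulVf// scale1r.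
  - by move=> _ u [r [p [Gp ->]]] /= E; apply: H.
(* The value proposed at [h u] is [u] itself. *)
have him u : exists u', G (h u, u').
  apply: (ext _ u) => r p u' Gp E.
  have pE : p.1 = h (u' - r *: u) by rewrite linearB linearZ -E addrK.
  by rewrite linearD linearZ/= (hG _ _ Gp pE) linearB linearZ subrK.
(* With the image of [h] inside the domain, the value [0] may be proposed at any other [x]: a
   relation [p.1 + r *: x = h u] with [r] nonzero would put [x] in the domain already. *)
have tot x : exists u, G (x, u).
  apply: contrapT => nx; apply: (nx); apply: (ext _ 0) => r p u Gp E.
  rewrite scaler0 addr0.
  have [r0|r0] := eqVneq r 0; first by apply: hG => //; rewrite -E r0 scale0r addr0.
  have [u' Gu'] := him u; case: nx; exists (r^-1 *: (u' - p.2)).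
  suff -> : (x, r^-1 *: (u' - p.2)) = r^-1 *: (- 1 *: p + (h u, u')) + 0.
    by apply: (lG) => //; apply: lG.
  rewrite addr0 scaleN1r; congr pair; last by rewrite /= addrC.
  by rewrite /= -E addKr scalerA mulVf// scale1r.
pose g x := projT1 (cid (tot x)).
have Gg x : G (x, g x) by exact: projT2 (cid (tot x)).
have g_eq x u : G (x, u) -> g x = u.
  move=> Gu; apply/eqP; rewrite -subr_eq0; apply/eqP; apply: fG.
  have := lG (-1) _ _ Gu (Gg x); rewrite scaleN1r addrC.
  by congr (G _); congr pair; rewrite /= subrr.
have lin_g : linear g.
  move=> a x y; apply: g_eq.
  exact: (lG a _ _ (Gg x) (Gg y)).
pose gl : {linear V -> U} := HB.pack g (GRing.isLinear.Build _ _ _ _ _ lin_g).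
by exists gl => u; apply: (hG _ _ (Gg (h u))).
Qed.
End GeneralizedInverse.

(** * C^oo-rings and derivations *)

Section CinfRings.
Variable R : realType.
Implicit Types X Y Z : cinfRing R.
Local Notation pd f i := (Cinf_partial f i : Cinf_ring R _).

Definition ch_comp X Y Z (g : cinfHom Y Z) (f : cinfHom X Y) : cinfHom X Z :=
  @CinfHom R X Z (g \o f) (fun m k x => etrans (congr1 g (ch_op f k x)) (ch_op g k _)).

Definition ch_id X : cinfHom X X := @CinfHom R X X id (fun _ _ _ => erefl).

Definition cr_ev X n (e : 'I_n -> X) : cinfHom (Cinf_ring R n) X :=
  @CinfHom R (Cinf_ring R n) X (fun f : Cinf_ring R n => cr_op f e)
    (fun m g f => cr_op_comp g f e).

Lemma ch_mul X Y (f : cinfHom X Y) : {morph f : x y / x * y}.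
Proof. by case: (ch_multiplicative f). Qed.

Lemma ch_add X Y (f : cinfHom X Y) : {morph f : x y / x + y}.
Proof. exact: linearD. Qed.

Lemma ch_sum X Y (f : cinfHom X Y) m (F : 'I_m -> X) :
  f (\sum_i F i) = \sum_i f (F i).
Proof. exact: linear_sum. Qed.

Lemma ch_1 X Y (f : cinfHom X Y) : f 1 = 1.
Proof. by case: (ch_multiplicative f). Qed.

Lemma cr_scalerAr X a (x y : X) : a *: (x * y) = x * (a *: y).
Proof. by rewrite mulrC cr_scalerAl mulrC. Qed.

Lemma Cinf_ring_sumE n m (F : 'I_m -> Cinf_ring R n) x :
  (\sum_i F i : Cinf_ring R n) x = \sum_i F i x.
Proof.
rewrite (big_morph (fun f : Cinf_ring R n => f x) (id1 := 0) (op1 := +%R))//.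
exact: (fun f g => Cinf_ringD f g x).
Qed.

Lemma Cinf_ring1E n x : (1 : Cinf_ring R n) x = 1.
Proof. by []. Qed.

Lemma cr_ev_scalar X n c (e : 'I_n -> X) :
  cr_ev e (c *: (1 : Cinf_ring R n)) = c *: (1 : X).
Proof. rewrite linearZ; congr (_ *: _); exact: ch_1. Qed.

Lemma cr_op_cst X n c (e : 'I_n -> X) : cr_op (Cinf_cst n c) e = c *: (1 : X).
Proof.
rewrite (_ : Cinf_cst n c = c *: (1 : Cinf_ring R n)); last first.
  by apply: Cinf_eq => x; rewrite Cinf_ringZ Cinf_ring1E mulr1.
exact: cr_ev_scalar.
Qed.

Lemma cr_op_reindex X n m (f : Cinf R n) (g : 'I_n -> 'I_m) (e : 'I_m -> X) :
  cr_op f (fun i => e (g i)) = cr_op (Cinf_comp f (fun i => Cinf_proj R (g i))) e.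
Proof.
by rewrite cr_op_comp; congr cr_op; apply/funext => i; rewrite cr_op_proj.
Qed.

Lemma Cinf_differentiable n (f : Cinf R n) x : differentiable f x.
Proof. by have [] := Cinf_smooth f 1%N. Qed.

Lemma Cinf_partialD n (f g : Cinf_ring R n) i :
  pd (f + g : Cinf_ring R n) i = pd f i + pd g i.
Proof.
apply: Cinf_eq => x; rewrite [RHS]Cinf_ringD /=.
rewrite (_ : (fun _ => _) = f \+ g); last by apply/funext => y; rewrite /= !mxE.
by rewrite deriveD//; apply/diff_derivable/Cinf_differentiable.
Qed.

Lemma Cinf_partialZ n a (f : Cinf_ring R n) i :
  pd (a *: f : Cinf_ring R n) i = a *: pd f i.
Proof.
apply: Cinf_eq => x; rewrite [RHS]Cinf_ringZ /=.
rewrite (_ : (fun _ => _) = a *: (f : _ -> R)); last by apply/funext => y; rewrite /= !mxE.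
by rewrite deriveZ//; apply/diff_derivable/Cinf_differentiable.
Qed.

Lemma Cinf_partialM n (f g : Cinf_ring R n) i :
  pd (f * g : Cinf_ring R n) i =
    f * pd g i + g * pd f i.
Proof.
apply: Cinf_eq => x; rewrite [RHS]Cinf_ringD [X in _ = X + _]Cinf_ringM.
rewrite [X in _ = _ + X]Cinf_ringM /=.
rewrite (_ : (fun _ => _) = (f : _ -> R) * (g : _ -> R)); last first.
  by apply/funext => y; rewrite /= !mxE.
by rewrite deriveM//; apply/diff_derivable/Cinf_differentiable.
Qed.

Lemma Cinf_partial_proj n (i j : 'I_n) :
  pd (Cinf_proj R i) j = (i == j)%:R *: (1 : Cinf_ring R n).
Proof.
apply: Cinf_eq => x; rewrite [RHS]Cinf_ringZ Cinf_ring1E mulr1 /=.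
have df y : differentiable (fun x : 'rV[R]_n => x 0 i) y by exact: differentiable_coord.
rewrite deriveE// (@diff_lin _ _ _ (HB.pack (fun x : 'rV[R]_n => x 0 i)
  (GRing.isLinear.Build _ _ _ _ (fun x : 'rV[R]_n => x 0 i : R)
    (fun a u v => etrans (mxE _ _ _ _) (congr1 (fun z => z + v 0 i) (mxE _ _ _ _)))))) /=.
  by rewrite mxE eqxx.
by move=> y; exact: differentiable_continuous.
Qed.

Lemma Cinf_partial_comp n m (g : Cinf R m) (f : 'I_m -> Cinf R n) i :
  pd (Cinf_comp g f) i =
    \sum_j (Cinf_comp (Cinf_partial g j) f : Cinf_ring R n) * pd (f j) i.
Proof.
apply: Cinf_eq => x; rewrite Cinf_ring_sumE /=.
rewrite derive_comp_row; [|by move=> j; exact: Cinf_differentiable|exact: Cinf_differentiable].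
by apply: eq_bigr => j _; rewrite !mxE.
Qed.

Lemma Cinf_addE : Cinf_add R = (Cinf_proj R 0 : Cinf_ring R 2) + Cinf_proj R 1 :> Cinf_ring R 2.
Proof. by apply: Cinf_eq => x; rewrite Cinf_ringD. Qed.

Lemma Cinf_mulE : Cinf_mul R = (Cinf_proj R 0 : Cinf_ring R 2) * Cinf_proj R 1 :> Cinf_ring R 2.
Proof. by apply: Cinf_eq => x; rewrite Cinf_ringM. Qed.

Lemma Cinf_scaleE c : Cinf_scale c = c *: (Cinf_proj R 0 : Cinf_ring R 1) :> Cinf_ring R 1.
Proof. by apply: Cinf_eq => x; rewrite Cinf_ringZ. Qed.

End CinfRings.

(* The square-zero extension of X by M: its C^oo-ring morphisms over X are the
   C^oo-derivations with values in M. *)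
Section SquareZero.
Variables (R : realType) (X : cinfRing R) (M : lmodType R).
Local Notation pd f i := (Cinf_partial f i : Cinf_ring R _).
Variable act : X -> M -> M.
Hypothesis act_bilinear : bilinear_for *:%R *:%R act.
Hypothesis actM : forall x y m, act (x * y) m = act x (act y m).
Hypothesis act1 : forall m, act 1 m = m.

Let actl m : {linear X -> M} :=
  HB.pack (act^~ m) (GRing.isLinear.Build _ _ _ _ _ (act_bilinear.1 m)).
Let actr x : {linear M -> M} :=
  HB.pack (act x) (GRing.isLinear.Build _ _ _ _ _ (act_bilinear.2 x)).

(** A pair [(x, m)] stands for [x + m eps] with [eps^2 = 0]; the second component is the first-order
    Taylor term of [f]. *)
Definition sqz_op m (f : Cinf R m) (z : 'I_m -> X * M) : X * M :=
  let x i := (z i).1 in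
  (cr_op f x, \sum_i act (cr_op (Cinf_partial f i) x) (z i).2).

Lemma sqz_op_proj m (i : 'I_m) (z : 'I_m -> X * M) : sqz_op (Cinf_proj R i) z = z i.
Proof.
rewrite /sqz_op cr_op_proj [RHS]surjective_pairing; congr pair.
have E j : cr_op (Cinf_partial (Cinf_proj R i) j) (fun k => (z k).1) = (i == j)%:R *: (1 : X).
  rewrite -[LHS]/(cr_ev _ (pd (Cinf_proj R i) j)) Cinf_partial_proj.
  exact: cr_ev_scalar.
rewrite (bigD1 i)//= E eqxx scale1r act1 big1 ?addr0// => j /negPf ji.
by rewrite E eq_sym ji scale0r -[LHS]/(actl _ _) linear0.
Qed.

(** The second components agree by the chain rule and an exchange of sums. *)
Lemma sqz_op_comp n m (g : Cinf R m) (f : 'I_m -> Cinf R n) (z : 'I_n -> X * M) :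
  sqz_op (Cinf_comp g f) z = sqz_op g (fun j => sqz_op (f j) z).
Proof.
rewrite /sqz_op /= cr_op_comp; congr pair; set x := fun i => (z i).1.
transitivity (\sum_i \sum_j act (cr_op (Cinf_partial g j) (fun j => cr_op (f j) x))
    (act (cr_op (Cinf_partial (f j) i) x) (z i).2)).
  apply: eq_bigr => i _.
  rewrite -[cr_op _ x]/(cr_ev x (pd (Cinf_comp g f) i)) Cinf_partial_comp linear_sum.
  rewrite -[LHS]/(actl _ _) linear_sum; apply: eq_bigr => j _ /=.
  rewrite -[LHS]/(act (cr_ev x ((Cinf_comp (Cinf_partial g j) f : Cinf_ring R n) *
    pd (f j) i)) (z i).2) ch_mul actM; congr (act _ _).
  exact: cr_op_comp.
rewrite exchange_big; apply: eq_bigr => j _ /=.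
by rewrite -[RHS]/(actr _ _) linear_sum.
Qed.

Definition sqz : cinfRing R := CinfRing sqz_op_proj sqz_op_comp.

Lemma sqz_add (z z' : sqz) : z + z' = (z.1 + z'.1, z.2 + z'.2).
Proof.
rewrite -[LHS]/(sqz_op (Cinf_add R) _) /sqz_op; set x := fun i => _.
congr pair; first by congr cr_op; apply/funext => i; rewrite /x /tup2; case: ifP.
have E j : cr_op (Cinf_partial (Cinf_add R) j) x = 1.
  rewrite -[LHS]/(cr_ev _ (pd (Cinf_add R) j)) Cinf_addE Cinf_partialD !Cinf_partial_proj.
  rewrite -scalerDl cr_ev_scalar.
  by case: j => [[|[|//]]] ?; rewrite /= ?addr0 ?add0r scale1r.
by rewrite big_ord_recl big_ord1 !E !act1.
Qed.

Lemma sqz_scale a (z : sqz) : a *: z = (a *: z.1, a *: z.2).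
Proof.
rewrite -[LHS]/(sqz_op (Cinf_scale a) _) /sqz_op; set x := fun i => _.
congr pair.
rewrite big_ord1 -[cr_op _ x]/(cr_ev _ (pd (Cinf_scale a) 0)) Cinf_scaleE.
rewrite Cinf_partialZ Cinf_partial_proj eqxx scale1r cr_ev_scalar.
by rewrite -[LHS]/(actl _ _) linearZ /= act1.
Qed.

End SquareZero.

(** * The derivation [d] on the free C^oo-ring *)

Section Derivation.
Variable R : realType.
Implicit Types V W : lmodType R.
Local Notation pd f i := (Cinf_partial f i : Cinf_ring R _).

Definition Sinf_act V (x : Sinf V) : {linear Sinf V \ox V -> Sinf V \ox V} :=
  tmap (HB.pack (fun y : Sinf V => x * y)
    (GRing.isLinear.Build _ _ _ _ _ ((cr_mul_bilinear (Sinf V)).2 x))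
    : {linear Sinf V -> Sinf V}) idfun.

Lemma Sinf_actE V (x y : Sinf V) v : Sinf_act x (tens y v) = tens (x * y) v.
Proof. exact: tmapE. Qed.

Lemma Sinf_act_bilinear V : bilinear_for *:%R *:%R (fun x : Sinf V => Sinf_act x).
Proof.
split=> [m a x y|x]; last exact: linearP.
apply: (@tensor_ext _ _ _ _ (Sinf_act (a *: x + y)) (a \*: Sinf_act x \+ Sinf_act y)) => z v /=.
rewrite !Sinf_actE mulrDl -(tens_bilinear _ _).1.
by rewrite cr_scalerAl.
Qed.

Lemma Sinf_actM V (x y : Sinf V) m : Sinf_act (x * y) m = Sinf_act x (Sinf_act y m).
Proof.
apply: (@tensor_ext _ _ _ _ (Sinf_act (x * y)) (Sinf_act x \o Sinf_act y)) => z v /=.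
by rewrite !Sinf_actE mulrA.
Qed.

Lemma Sinf_act1 V m : Sinf_act (1 : Sinf V) m = m.
Proof.
apply: (@tensor_ext _ _ _ _ (Sinf_act (1 : Sinf V)) idfun) => z v.
by rewrite Sinf_actE mul1r.
Qed.

Definition Sinf_sqz V : cinfRing R :=
  sqz (@Sinf_act_bilinear V) (@Sinf_actM V) (@Sinf_act1 V).

Lemma Sinf_dgen_linear V :
  linear (fun v : V => (Sinf_eta V v, tens (1 : Sinf V) v) : Sinf_sqz V).
Proof.
move=> a u v; rewrite sqz_add sqz_scale; congr pair; first exact: (linearP (Sinf_eta V)).
exact: (tens_bilinear _ _).2.
Qed.

Definition Sinf_dgen V : {linear V -> Sinf_sqz V} :=
  HB.pack (fun v : V => (Sinf_eta V v, tens (1 : Sinf V) v) : Sinf_sqz V)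
    (GRing.isLinear.Build _ _ _ _ _ (@Sinf_dgen_linear V)).

(** Freeness extends [v |-> (v, 1 (x) v)] to a morphism into the square-zero extension. It is a
    section of the first projection, so its second component is a C^oo-derivation, which is taken as
    [d]. *)
Definition Sinf_dlift V : cinfHom (Sinf V) (Sinf_sqz V) := Sinf_lift (Sinf_dgen V).

Lemma Sinf_dlift_eta V v : Sinf_dlift V (Sinf_eta V v) = (Sinf_eta V v, tens (1 : Sinf V) v).
Proof. exact: (Sinf_lift_eta (Sinf_dgen V)). Qed.

Lemma Sinf_dlift_fst V x : (Sinf_dlift V x).1 = x.
Proof.
pose f : cinfHom (Sinf_sqz V) (Sinf V) := @CinfHom R (Sinf_sqz V) (Sinf V) fst (fun _ _ _ => erefl).
apply: (@Sinf_hom_ext _ _ _ (ch_comp f (Sinf_dlift V)) (ch_id _)) => v.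
exact: (congr1 fst (Sinf_dlift_eta v)).
Qed.

Lemma Sinf_d_linear V : linear (fun x : Sinf V => (Sinf_dlift V x).2).
Proof.
move=> a x y.
have -> : Sinf_dlift V (a *: x + y) = a *: Sinf_dlift V x + Sinf_dlift V y by exact: linearP.
by rewrite sqz_add sqz_scale.
Qed.

Definition Sinf_d V : {linear Sinf V -> Sinf V \ox V} :=
  HB.pack (fun x : Sinf V => (Sinf_dlift V x).2)
    (GRing.isLinear.Build _ _ _ _ _ (@Sinf_d_linear V)).

Lemma Sinf_d_eta V v : Sinf_d V (Sinf_eta V v) = tens (1 : Sinf V) v.
Proof. exact: (congr1 snd (Sinf_dlift_eta v)). Qed.

Lemma Sinf_d_op V m (f : Cinf R m) (x : 'I_m -> Sinf V) :
  Sinf_d V (cr_op f x) = \sum_i Sinf_act (cr_op (Cinf_partial f i) x) (Sinf_d V (x i)).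
Proof.
rewrite -[LHS]/((Sinf_dlift V (cr_op f x)).2) ch_op.
apply: eq_bigr => i _; congr (Sinf_act (cr_op _ _) _).
by apply/funext => j; apply: Sinf_dlift_fst.
Qed.

Lemma Sinf_d_mul V (x y : Sinf V) :
  Sinf_d V (x * y) = Sinf_act x (Sinf_d V y) + Sinf_act y (Sinf_d V x).
Proof.
rewrite -[x * y]/(cr_op (Cinf_mul R) (tup2 x y)) Sinf_d_op big_ord_recl big_ord1.
have E i : cr_op (Cinf_partial (Cinf_mul R) i) (tup2 x y) = (i == 1)%:R *: x + (i == 0)%:R *: y.
  rewrite -[LHS]/(cr_ev _ (pd (Cinf_mul R) i)) Cinf_mulE Cinf_partialM !Cinf_partial_proj.
  rewrite -!cr_scalerAr !mulr1 [i == 1]eq_sym [i == 0]eq_sym linearD !linearZ.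
  by congr (_ *: _ + _ *: _); exact: cr_op_proj.
by rewrite !E /= !scale1r !scale0r add0r addr0 addrC.
Qed.

Lemma tens_act V (x : Sinf V) v : tens x v = Sinf_act x (tens (1 : Sinf V) v).
Proof. by rewrite Sinf_actE mulr1. Qed.

Lemma Sinf_map_eta V W (h : {linear V -> W}) v :
  Sinf_map h (Sinf_eta V v) = Sinf_eta W (h v).
Proof. exact: Sinf_lift_eta. Qed.

Lemma Sinf_map_op V W (h : {linear V -> W}) m (f : Cinf R m) (x : 'I_m -> Sinf V) :
  Sinf_map h (cr_op f x) = cr_op f (fun i => Sinf_map h (x i)).
Proof. exact: ch_op. Qed.

Lemma Sinf_map_mul V W (h : {linear V -> W}) : {morph Sinf_map h : x y / x * y}.
Proof. exact: ch_mul. Qed.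

Lemma Sinf_map_1 V W (h : {linear V -> W}) : Sinf_map h (1 : Sinf V) = 1.
Proof. exact: ch_1. Qed.

Lemma Sinf_map_comp (U V W : lmodType R) (g : {linear V -> W}) (h : {linear U -> V}) x :
  Sinf_map (g \o h) x = Sinf_map g (Sinf_map h x).
Proof.
apply: (@Sinf_hom_ext _ _ _ (Sinf_lift (Sinf_eta W \o (g \o h)))
  (ch_comp (Sinf_lift (Sinf_eta W \o g)) (Sinf_lift (Sinf_eta V \o h)))) => v /=.
by rewrite -[RHS]/(Sinf_map g (Sinf_map h _)) !Sinf_map_eta [LHS]Sinf_map_eta.
Qed.

(** * Elements of the free ring as smooth functions of finitely many vectors *)

Section Representation.
Variable V : lmodType R.

(** The lists of vectors are concatenated and each function is precomposed with the projections onto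
    its own block. Common variables are what the induction on terms in [Sinf_rep] requires. *)
Lemma Sinf_family_rep m (x : 'I_m -> Sinf V) :
  (forall j, exists n (v : 'I_n -> V) (f : Cinf R n),
     x j = cr_op f (fun i => Sinf_eta V (v i))) ->
  exists n (v : 'I_n -> V) (f : 'I_m -> Cinf R n),
    forall j, x j = cr_op (f j) (fun i => Sinf_eta V (v i)).
Proof.
elim: m x => [|m IH] x rep.
  exists 0%N, (fun=> 0), (fun=> Cinf_cst 0 0); case=> //.
have [n [v [f E]]] := IH _ (fun j => rep (lift ord0 j)).
have [n0 [v0 [f0 E0]]] := rep ord0.
exists (n + n0)%N, (fun i => match fintype.split i with inl a => v a | inr b => v0 b end).
exists (fun j => match unlift ord0 j with
  | Some j' => Cinf_comp (f j') (fun i => Cinf_proj R (lshift n0 i))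
  | None => Cinf_comp f0 (fun i => Cinf_proj R (rshift n i)) end) => j.
case: unliftP => [j' ->|->]; rewrite -cr_op_reindex.
  rewrite E; congr cr_op; apply/funext => i.
  case: splitP => [k ik|k /= ik]; first by congr (Sinf_eta V (v _)); exact: val_inj.
  by have := ltn_ord i; rewrite ik ltnNge leq_addr.
rewrite E0; congr cr_op; apply/funext => i.
case: splitP => [k /= ik|k /= /addnI ik]; last by congr (Sinf_eta V (v0 _)); exact: val_inj.
by have := ltn_ord k; rewrite -ik ltnNge leq_addr.
Qed.

Lemma Sinf_rep (x : Sinf V) : exists n (v : 'I_n -> V) (f : Cinf R n),
  x = cr_op f (fun i => Sinf_eta V (v i)).
Proof.
rewrite -[x]reprK; elim: (repr x) => [v|m c s IH].
  by exists 1%N, (fun=> v), (Cinf_proj R 0); rewrite cr_op_proj.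
have [n [v [f E]]] := Sinf_family_rep IH.
exists n, v, (Cinf_comp c f); rewrite cr_op_comp.
apply: Sinf_eval_inj => X h; rewrite Sinf_eval_pi -[RHS]/(Sinf_lift h _) ch_op.
by congr cr_op; apply/funext => i; rewrite -E [RHS]Sinf_eval_pi.
Qed.

Definition lin_comb n (v : 'I_n -> V) (a : 'rV[R]_n) : V := \sum_i a 0 i *: v i.
Lemma lin_comb_linear n (v : 'I_n -> V) : linear (lin_comb v).
Proof.
move=> r a b; rewrite /lin_comb scaler_sumr -big_split; apply: eq_bigr => i _ /=.
by rewrite !mxE scalerDl scalerA.
Qed.
HB.instance Definition _ n v := GRing.isLinear.Build R 'rV[R]_n V *:%R (@lin_comb n v)
  (@lin_comb_linear n v).

(** With [Sinf_rep], every element of [Sinf V] is the image of a smooth function on some [R^n] under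
    a linear map, so natural transformations are determined there. *)
Lemma Sinf_map_rep n (v : 'I_n -> V) (f : Cinf R n) :
  Sinf_map (lin_comb v : {linear _ -> _}) (Sinf_of_Cinf f) =
  cr_op f (fun i => Sinf_eta V (v i)).
Proof.
rewrite Sinf_map_op; congr cr_op; apply/funext => i; rewrite Sinf_map_eta.
suff -> : (lin_comb v : {linear _ -> _}) 'e_i = v i by [].
rewrite /= /lin_comb (bigD1 i)//= mxE !eqxx scale1r big1 ?addr0// => j /negPf ji.
by rewrite mxE ji scale0r.
Qed.
End Representation.
End Derivation.

(** * The Euler operator and K *)

Section Euler.
Variable R : realType.
Implicit Types V W : lmodType R.
Local Notation pd f i := (Cinf_partial f i : Cinf_ring R _).

Lemma coderivingE V (x : Sinf V) v : coderiving V (tens x v) = x * Sinf_eta V v.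
Proof. by rewrite /coderiving [LHS]/= tmapE [LHS]Sinf_mulE. Qed.

(** [d^o] is linear over the ring [Sinf V], so composing [d] with it gives a derivation of that ring
    into itself. *)
Lemma coderiving_act V (x : Sinf V) m :
  coderiving V (Sinf_act x m) = x * coderiving V m.
Proof.
pose L : {linear Sinf V -> Sinf V} := HB.pack (fun y : Sinf V => x * y)
  (GRing.isLinear.Build _ _ _ _ _ ((cr_mul_bilinear (Sinf V)).2 x)).
apply: (@tensor_ext _ _ _ _ (coderiving V \o Sinf_act x) (L \o coderiving V)) => y v.
rewrite -[LHS]/(coderiving V (Sinf_act x _)) Sinf_actE coderivingE -mulrA.
by rewrite -[RHS]/(x * coderiving V _) coderivingE.
Qed.

Lemma coderiving_natural V W (h : {linear V -> W}) m :
  coderiving W (tmap (Sinf_map h) h m) = Sinf_map h (coderiving V m).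
Proof.
apply: (@tensor_ext _ _ _ _ (coderiving W \o tmap (Sinf_map h) h)
  (Sinf_map h \o coderiving V)) => x v.
rewrite -[LHS]/(coderiving W _) tmapE coderivingE.
by rewrite -[RHS]/(Sinf_map h _) coderivingE Sinf_map_mul Sinf_map_eta.
Qed.

Lemma Sinf_d_natural V W (h : {linear V -> W}) x :
  Sinf_d W (Sinf_map h x) = tmap (Sinf_map h) h (Sinf_d V x).
Proof.
have [n [v [f ->]]] := Sinf_rep x.
rewrite Sinf_map_op !Sinf_d_op linear_sum; apply: eq_bigr => i _.
rewrite Sinf_map_eta !Sinf_d_eta -!tens_act tmapE Sinf_map_op.
by [].
Qed.

Lemma Sinf_d_Cinf n (f : Cinf R n) :
  Sinf_d 'rV[R]_n (Sinf_of_Cinf f) = one_form (Cinf_partial f).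
Proof.
rewrite Sinf_d_op; apply: eq_bigr => i _.
by rewrite Sinf_d_eta -tens_act.
Qed.

Lemma is_deriving_Sinf_d : is_deriving (@Sinf_d R).
Proof.
split=> [V W h x|n f]; last exact: Sinf_d_Cinf.
exact: Sinf_d_natural.
Qed.

Lemma deriving_unique (d : forall V, {linear Sinf V -> Sinf V \ox V}) :
  is_deriving d -> forall V, d V =1 Sinf_d V.
Proof.
move=> [dn dC] V x; have [n [v [f ->]]] := Sinf_rep x.
rewrite -Sinf_map_rep Sinf_d_natural Sinf_d_Cinf.
by rewrite -[LHS]/((d V \o Sinf_map _) _) dn /= dC.
Qed.

Definition euler V : {linear Sinf V -> Sinf V} := coderiving V \o Sinf_d V.

Lemma euler_eta V v : euler V (Sinf_eta V v) = Sinf_eta V v.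
Proof. by rewrite -[LHS]/(coderiving V (Sinf_d V _)) Sinf_d_eta coderivingE mul1r. Qed.

Lemma euler_op V m (f : Cinf R m) (x : 'I_m -> Sinf V) :
  euler V (cr_op f x) = \sum_i cr_op (Cinf_partial f i) x * euler V (x i).
Proof.
rewrite -[LHS]/(coderiving V (Sinf_d V _)) Sinf_d_op linear_sum.
by apply: eq_bigr => i _; apply: coderiving_act.
Qed.

Lemma euler_mul V (x y : Sinf V) : euler V (x * y) = x * euler V y + y * euler V x.
Proof.
rewrite -[LHS]/(coderiving V (Sinf_d V _)) Sinf_d_mul linearD.
by congr (_ + _); apply: coderiving_act.
Qed.

Lemma euler_natural V W (h : {linear V -> W}) x :
  euler W (Sinf_map h x) = Sinf_map h (euler V x).
Proof.
by rewrite -[LHS]/(coderiving W (Sinf_d W _)) Sinf_d_natural coderiving_natural.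
Qed.

(** The augmentation: evaluation at the origin, seen as a constant ([Sinf_aug_op]). *)
Definition Sinf_aug V : {linear Sinf V -> Sinf V} := Sinf_map (\0 : {linear V -> V}).

Lemma Sinf_aug_eta V v : Sinf_aug V (Sinf_eta V v) = 0.
Proof. by rewrite /Sinf_aug Sinf_map_eta linear0. Qed.

Lemma Sinf_aug_mul V (x y : Sinf V) : Sinf_aug V (x * y) = Sinf_aug V x * Sinf_aug V y.
Proof. exact: Sinf_map_mul. Qed.

Lemma Sinf_aug_idem V x : Sinf_aug V (Sinf_aug V x) = Sinf_aug V x.
Proof.
rewrite /Sinf_aug -Sinf_map_comp.
apply: (@Sinf_hom_ext _ _ _ (Sinf_lift _) (Sinf_lift _)) => v.
by rewrite !Sinf_lift_eta.
Qed.

Lemma Sinf_aug_coderiving V m : Sinf_aug V (coderiving V m) = 0.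
Proof.
apply: (@tensor_ext _ _ _ _ (Sinf_aug V \o coderiving V) \0) => x v.
by rewrite -[LHS]/(Sinf_aug V _) coderivingE Sinf_aug_mul Sinf_aug_eta mulr0.
Qed.

Lemma euler_aug V x : euler V (Sinf_aug V x) = 0.
Proof. by rewrite euler_natural -[LHS]/(Sinf_aug V (coderiving V _)) Sinf_aug_coderiving. Qed.

Lemma Sinf_aug_op V n (v : 'I_n -> V) (f : Cinf R n) :
  Sinf_aug V (cr_op f (fun i => Sinf_eta V (v i))) = f 0 *: (1 : Sinf V).
Proof.
rewrite /Sinf_aug Sinf_map_op -(cr_op_cst _ (fun i => Sinf_eta V (v i))).
rewrite (_ : Cinf_cst n (f 0) = Cinf_comp f (fun=> Cinf_cst n 0)).
  rewrite cr_op_comp; congr cr_op; apply/funext => i.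
  by rewrite [LHS]Sinf_aug_eta cr_op_cst scale0r.
apply: Cinf_eq => x /=; congr (f _); by apply/rowP => j; rewrite !mxE.
Qed.

Local Notation K V := (Kmap (@Sinf_d R) V).

Lemma KmapE V x : K V x = euler V x + Sinf_aug V x.
Proof. by []. Qed.

Lemma Kmap_natural V W (h : {linear V -> W}) x :
  K W (Sinf_map h x) = Sinf_map h (K V x).
Proof.
rewrite !KmapE euler_natural linearD; congr (_ + _).
rewrite /Sinf_aug -!Sinf_map_comp.
apply: (@Sinf_hom_ext _ _ _ (Sinf_lift _) (Sinf_lift _)) => v.
rewrite !Sinf_lift_eta; exact: (congr1 (Sinf_eta W) (esym (linear0 h))).
Qed.

Lemma Sinf_aug_Kmap V x : Sinf_aug V (K V x) = Sinf_aug V x.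
Proof. by rewrite KmapE linearD Sinf_aug_idem [X in X + _]Sinf_aug_coderiving add0r. Qed.

(** The augmentation kills the image of [d^o] and is unchanged by [K], so applying it to the
    equation separates the two summands of [K]. *)
Lemma Kmap_coderivingP V x m :
  K V x = coderiving V m <-> euler V x = coderiving V m /\ Sinf_aug V x = 0.
Proof.
rewrite KmapE; split=> [E|[-> ->]]; last by rewrite addr0.
have a0 : Sinf_aug V x = 0 by rewrite -Sinf_aug_Kmap KmapE E Sinf_aug_coderiving.
by rewrite -E a0 addr0.
Qed.

(** * Coordinate form and injectivity of [K] *)

Definition Cinf_K n (f : Cinf R n) : Cinf_ring R n :=
  (\sum_i pd f i * Cinf_proj R i) + f 0 *: (1 : Cinf_ring R n).

Lemma Kmap_op V n (v : 'I_n -> V) (f : Cinf R n) :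
  let e i := Sinf_eta V (v i) in K V (cr_op f e) = cr_op (Cinf_K f) e.
Proof.
move=> e; rewrite KmapE Sinf_aug_op euler_op.
rewrite -[RHS]/(cr_ev e (Cinf_K f)) /Cinf_K ch_add cr_ev_scalar; congr (_ + _).
rewrite ch_sum; apply: eq_bigr => i _.
rewrite -[RHS]/(cr_ev e (pd f i * Cinf_proj R i)) ch_mul euler_eta; congr (_ * _).
by rewrite -[RHS]/(cr_op _ _) cr_op_proj.
Qed.

Lemma Cinf_K_eq0 n (f : Cinf_ring R n) : Cinf_K f = 0 -> f = 0.
Proof.
move=> Kf; apply: Cinf_eq => x; apply: (euler_eq0 x (Cinf_smooth f)) => y.
have : Cinf_K f y = 0 by rewrite Kf.
rewrite /Cinf_K Cinf_ringD Cinf_ring_sumE Cinf_ringZ Cinf_ring1E mulr1 addrC => E; rewrite -[RHS]E.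
by congr (_ + _); apply: eq_bigr => i _; rewrite Cinf_ringM mulrC.
Qed.

(** The vectors [v] may be dependent, so [K V x = 0] need not give [Cinf_K f = 0]. With [h g h = h],
    the element [S(g) x] of [Sinf 'rV[R]_n] is killed by [K], hence zero by the analytic case, and
    [S(h)] maps it back to [x]. *)
Lemma Kmap_eq0 V x : K V x = 0 -> x = 0.
Proof.
have [n [v [f ->]]] := Sinf_rep x; rewrite -Sinf_map_rep.
set h : {linear _ -> _} := lin_comb v => Kx.
have [g hgh] := linear_generalized_inverse h.
set y := Sinf_of_Cinf f in Kx *.
suff gy0 : Sinf_map g (Sinf_map h y) = 0.
  have <- : Sinf_map h (Sinf_map g (Sinf_map h y)) = Sinf_map h y.
    rewrite -!Sinf_map_comp.
    apply: (@Sinf_hom_ext _ _ _ (Sinf_lift _) (Sinf_lift _)) => a.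
    by rewrite !Sinf_lift_eta /= hgh.
  by rewrite gy0 linear0.
have : K _ (Sinf_map g (Sinf_map h y)) = 0 by rewrite Kmap_natural Kx linear0.
move: (Sinf_map g _) => z; rewrite -[z]Cinf_of_SinfK; move: (Cinf_of_Sinf R n z) => f'.
rewrite Kmap_op -[LHS]/(Sinf_of_Cinf _).
move=> /(congr1 (Cinf_of_Sinf R n)); rewrite Sinf_of_CinfK linear0 => /Cinf_K_eq0 ->.
exact: (linear0 (cr_ev _)).
Qed.

Lemma Kmap_inj V : injective (K V).
Proof.
move=> x y xy; apply/eqP; rewrite -subr_eq0; apply/eqP; apply: Kmap_eq0.
by rewrite linearB xy subrr.
Qed.

(** * Inversion of [E + 1] and surjectivity of [K] *)

Definition Cinf_radial n (f : Cinf R n) : Cinf R n :=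
  MkCinf (radial_mean_smooth 0 (Cinf_smooth f)).

Lemma euler_radial V n (v : 'I_n -> V) (f : Cinf R n) :
  let e i := Sinf_eta V (v i) in
  cr_op (Cinf_radial f) e + euler V (cr_op (Cinf_radial f) e) = cr_op f e.
Proof.
move=> e; rewrite euler_op.
have fE : f = (Cinf_radial f : Cinf_ring R n) +
    \sum_i pd (Cinf_radial f) i * Cinf_proj R i :> Cinf_ring R n.
  apply: Cinf_eq => x; rewrite -[LHS](radial_mean_euler x (Cinf_smooth f)).
  rewrite Cinf_ringD Cinf_ring_sumE; congr (_ + _); apply: eq_bigr => i _.
  by rewrite Cinf_ringM mulrC.
rewrite [in RHS]fE -[RHS]/(cr_ev e _) ch_add; congr (_ + _).
rewrite ch_sum; apply: eq_bigr => i _.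
rewrite -[RHS]/(cr_ev e (pd _ i * Cinf_proj R i)) ch_mul euler_eta; congr (_ * _).
by rewrite -[RHS]/(cr_op _ _) cr_op_proj.
Qed.

Lemma euler_succ_surj V (x : Sinf V) : exists y, y + euler V y = x.
Proof.
have [n [v [f ->]]] := Sinf_rep x; eexists; exact: euler_radial.
Qed.

(* Hadamard's lemma x = S(0) x + sum_i e_i y_i, with (E + 1) y_i the i-th partial
   derivative of x, holds because both sides have the same image under K. *)
Lemma Kmap_surj V (x : Sinf V) : exists y, K V y = x.
Proof.
have [n [v [f xE]]] := Sinf_rep x; pose e i := Sinf_eta V (v i).
pose y i := cr_op (Cinf_radial (Cinf_partial f i)) e.
have had : x = Sinf_aug V x + \sum_i e i * y i.
  apply: Kmap_inj; rewrite [in RHS]KmapE !linearD euler_aug Sinf_aug_idem add0r.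
  rewrite (linear_sum (Sinf_aug V)) [X in _ + (_ + X)]big1 ?addr0; last first.
    by move=> i _; rewrite Sinf_aug_mul Sinf_aug_eta mul0r.
  rewrite KmapE; congr (_ + _); rewrite {1}xE euler_op linear_sum.
  apply: eq_bigr => i _; rewrite euler_mul euler_eta -/(e i).
  by rewrite -(euler_radial v (Cinf_partial f i)) -/e -/(y i) [y i * _]mulrC -mulrDr addrC mulrC.
(* Inverting [E + 1] a second time: [E (e i * u i) = e i * (u i + E (u i)) = e i * y i], so [K]
   sends the witness to the Hadamard expansion of [x]. *)
have [u uE] := choice (fun i => euler_succ_surj (y i)).
exists (Sinf_aug V x + \sum_i e i * u i).
rewrite [RHS]had KmapE !linearD euler_aug Sinf_aug_idem add0r.
rewrite (linear_sum (Sinf_aug V)) [X in _ + (_ + X)]big1 ?addr0; last first.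
  by move=> i _; rewrite Sinf_aug_mul Sinf_aug_eta mul0r.
rewrite addrC; congr (_ + _); rewrite linear_sum; apply: eq_bigr => i _.
by rewrite euler_mul euler_eta -uE [u i * _]mulrC -mulrDr addrC.
Qed.

Lemma Kmap_inverse V : exists Kinv : {linear Sinf V -> Sinf V},
  cancel (K V) Kinv /\ cancel Kinv (K V).
Proof.
pose k (x : Sinf V) := projT1 (cid (Kmap_surj x)).
have kK x : K V (k x) = x by exact: projT2 (cid (Kmap_surj x)).
have lin_k : linear k by move=> a x y; apply: Kmap_inj; rewrite linearP !kK.
pose kl : {linear Sinf V -> Sinf V} :=
  HB.pack k (GRing.isLinear.Build _ _ _ _ _ lin_k).
exists kl; split=> //= x.
by apply: Kmap_inj; rewrite kK.
Qed.
End Euler.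

(** * The integral transformation *)

Section Modality.
Variable R : realType.
Implicit Types A B C D V W : lmodType R.

Lemma tens_linearl A B (b : B) : linear (fun a : A => tens a b).
Proof. exact: (tens_bilinear A B).1. Qed.
Lemma tens_linearr A B (a : A) : linear (fun b : B => tens a b).
Proof. exact: (tens_bilinear A B).2. Qed.
Definition tensl A B (b : B) : {linear A -> A \ox B} :=
  HB.pack (fun a : A => tens a b) (GRing.isLinear.Build _ _ _ _ _ (@tens_linearl A B b)).
Definition tensr A B (a : A) : {linear B -> A \ox B} :=
  HB.pack (fun b : B => tens a b) (GRing.isLinear.Build _ _ _ _ _ (@tens_linearr A B a)).

Lemma tensor3_ext A B C W (f g : {linear (A \ox B) \ox C -> W}) :
  (forall a b c, f (tens (tens a b) c) = g (tens (tens a b) c)) -> f =1 g.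
Proof.
move=> fg; apply: tensor_ext => p c.
by apply: (@tensor_ext _ _ _ _ (f \o tensl _ c) (g \o tensl _ c)) => a b; exact: fg.
Qed.

Lemma tensor4_ext A B C D W (f g : {linear (A \ox B) \ox (C \ox D) -> W}) :
  (forall a b c d, f (tens (tens a b) (tens c d)) = g (tens (tens a b) (tens c d))) ->
  f =1 g.
Proof.
move=> fg; apply: tensor3_ext => a b q.
by apply: (@tensor_ext _ _ _ _ (f \o tensr _ (tens a b))
  (g \o tensr _ (tens a b))) => c d; exact: fg.
Qed.

Lemma Sinf_mu_eta V (x : Sinf V) : Sinf_mu V (Sinf_eta (Sinf V) x) = x.
Proof. exact: (Sinf_lift_eta (idfun : {linear Sinf V -> Sinf V})). Qed.

Lemma Sinf_mu_mul V : {morph Sinf_mu V : x y / x * y}.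
Proof. exact: ch_mul. Qed.

Lemma Sinf_mu_1 V : Sinf_mu V (1 : Sinf (Sinf V)) = 1.
Proof. exact: ch_1. Qed.

Lemma Sinf_map_scale V W (h : {linear V -> W}) (a : R) x :
  Sinf_map h (a *: x) = a *: Sinf_map h x.
Proof. by rewrite linearZ. Qed.

Lemma Sinf_mu_scale V (a : R) (x : Sinf (Sinf V)) :
  Sinf_mu V (a *: x) = a *: Sinf_mu V x.
Proof. by rewrite linearZ. Qed.

Lemma Sinf_unitE V r : Sinf_unit V r = (r : R) *: (1 : Sinf V).
Proof. by []. Qed.

(** Equations between C^oo-ring morphisms are checked on generators with [Sinf_hom_ext], and
    equations out of a tensor product on pure tensors. *)
Lemma Sinf_algebra_modality : algebra_modality (Sinf_modality R).
Proof.
split; rewrite /Sinf_modality /=.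
- move=> A; apply: (@Sinf_hom_ext _ _ _ (Sinf_lift _) (ch_id _)) => v.
  by rewrite Sinf_lift_eta.
- move=> A B C f g x; exact: Sinf_map_comp.
- move=> A B h.
  apply: (@Sinf_hom_ext _ _ _
    (ch_comp (Sinf_lift (idfun : {linear Sinf B -> Sinf B})) (Sinf_lift _))
    (ch_comp (Sinf_lift _) (Sinf_lift (idfun : {linear Sinf A -> Sinf A})))) => x.
  rewrite -[LHS]/(Sinf_mu B (Sinf_map (Sinf_map h) (Sinf_eta _ x))) Sinf_map_eta Sinf_mu_eta.
  by rewrite -[RHS]/(Sinf_map h (Sinf_mu A (Sinf_eta _ x))) Sinf_mu_eta.
- by move=> A B h v; rewrite -[RHS]/(Sinf_map h (Sinf_eta A v)) Sinf_map_eta.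
- by move=> A x; exact: Sinf_mu_eta.
- move=> A; apply: (@Sinf_hom_ext _ _ _ (ch_comp (Sinf_lift _) (Sinf_lift _)) (ch_id _)) => v.
  by rewrite -[LHS]/(Sinf_mu A (Sinf_map (Sinf_eta A) (Sinf_eta A v))) Sinf_map_eta Sinf_mu_eta.
- move=> A; pose mu := Sinf_lift (idfun : {linear Sinf A -> Sinf A}).
  apply: (@Sinf_hom_ext _ _ _
    (ch_comp mu (Sinf_lift (idfun : {linear Sinf (Sinf A) -> Sinf (Sinf A)})))
    (ch_comp mu (Sinf_lift _))) => x.
  rewrite -[LHS]/(Sinf_mu A (Sinf_mu (Sinf A) (Sinf_eta _ x))) Sinf_mu_eta.
  by rewrite -[RHS]/(Sinf_mu A (Sinf_map (Sinf_mu A) (Sinf_eta _ x))) Sinf_map_eta Sinf_mu_eta.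
- move=> A B h.
  apply: (@tensor_ext _ _ _ _ (Sinf_mul B \o tmap (Sinf_map h) (Sinf_map h))
    (Sinf_map h \o Sinf_mul A)) => x y.
  rewrite -[LHS]/(Sinf_mul B (tmap _ _ _)) tmapE -[RHS]/(Sinf_map h (Sinf_mul A _)).
  by rewrite !Sinf_mulE Sinf_map_mul.
- move=> A B h r; rewrite -[RHS]/(Sinf_map h (Sinf_unit A r)) !Sinf_unitE.
  by rewrite Sinf_map_scale Sinf_map_1.
- move=> A; pose m := Sinf_mul A.
  apply: (@tensor3_ext _ _ _ _ (m \o tmap m idfun) (m \o tmap idfun m \o @tassoc R _ _ _)) => x y z.
  rewrite -[LHS]/(m (tmap m idfun _)) tmapE -[RHS]/(m (tmap idfun m (tassoc _ _ _ _))).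
  by rewrite tassocE tmapE /m !Sinf_mulE mulrA.
- move=> A; apply: (@tensor_ext _ _ _ _ (Sinf_mul A \o @tsym R _ _) (Sinf_mul A)) => x y.
  by rewrite -[LHS]/(Sinf_mul A (tsym _ _ _)) tsymE !Sinf_mulE mulrC.
- move=> A; apply: (@tensor_ext _ _ _ _ (Sinf_mul A \o tmap (Sinf_unit A) idfun)
    (@tunitl R _)) => r x.
  by rewrite -[LHS]/(Sinf_mul A (tmap _ _ _)) tmapE tunitlE Sinf_mulE Sinf_unitE -cr_scalerAl mul1r.
- move=> A; apply: (@tensor_ext _ _ _ _ (Sinf_mu A \o Sinf_mul (Sinf A))
    (Sinf_mul A \o tmap (Sinf_mu A) (Sinf_mu A))) => x y.
  rewrite -[RHS]/(Sinf_mul A (tmap _ _ _)) tmapE Sinf_mulE.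
  by rewrite -[LHS]/(Sinf_mu A (Sinf_mul _ _)) Sinf_mulE Sinf_mu_mul.
- move=> A r; rewrite -[LHS]/(Sinf_mu A (Sinf_unit _ r)) !Sinf_unitE.
  by rewrite Sinf_mu_scale Sinf_mu_1.
Qed.

(** * The axioms of an integral transformation, from [K s = d^o] *)

Section Integral.
Variable s : forall V, {linear Sinf V \ox V -> Sinf V}.
Hypothesis Ks : forall V m, Kmap (@Sinf_d R) V (s V m) = coderiving V m.

Let euler_s V m : euler V (s V m) = coderiving V m.
Proof. by have [] := (Kmap_coderivingP _ _).1 (Ks m). Qed.

Let Sinf_aug_s V m : Sinf_aug V (s V m) = 0.
Proof. by have [] := (Kmap_coderivingP _ _).1 (Ks m). Qed.

Lemma Sint_eq V m z : euler V z = coderiving V m -> Sinf_aug V z = 0 -> s V m = z.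
Proof. by move=> Ez az; apply: Kmap_inj; rewrite Ks; apply/esym/Kmap_coderivingP. Qed.

(** [s] depends on a tensor only through its image under [d^o], so two tensors with the same product
    have the same integral. *)
Lemma Sint_ext V m m' : coderiving V m = coderiving V m' -> s V m = s V m'.
Proof. by move=> E; apply: Sint_eq; rewrite ?euler_s ?Sinf_aug_s. Qed.

Lemma Sint_natural V W (h : {linear V -> W}) m :
  s W (tmap (Sinf_map h) h m) = Sinf_map h (s V m).
Proof.
by apply: Kmap_inj; rewrite Ks coderiving_natural Kmap_natural Ks.
Qed.

Lemma Sint_unit V (r : R) v : s V (tens (r *: (1 : Sinf V)) v) = Sinf_eta V (r *: v).
Proof.
apply: Sint_eq; last exact: Sinf_aug_eta.
by rewrite euler_eta coderivingE -cr_scalerAl mul1r linearZ.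
Qed.

(** Integration by parts: the Leibniz rule for [E] on the left-hand product gives [d^o] of the
    tensors on the right, and the augmentation of the product is zero. *)
Lemma Sint_rota_baxter V (x y : Sinf V) a b :
  s V (tens x a) * s V (tens y b) =
  s V (tens (s V (tens x a) * y) b) + s V (tens (x * s V (tens y b)) a).
Proof.
rewrite -linearD; apply/esym/Sint_eq; last by rewrite Sinf_aug_mul !Sinf_aug_s mulr0.
rewrite euler_mul !euler_s linearD !coderivingE; congr (_ + _); first by rewrite mulrA.
by rewrite mulrA [s _ _ * _]mulrC.
Qed.

(** Since [E a = a] for a generator, [E (a y) = a (y + E y)]. As [E + 1] is onto, this computes [s]
    on every pure tensor. *)
Lemma Sint_tens V (y : Sinf V) a : s V (tens (y + euler V y) a) = Sinf_eta V a * y.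
Proof.
apply: Sint_eq; last by rewrite Sinf_aug_mul Sinf_aug_eta mul0r.
by rewrite euler_mul euler_eta coderivingE mulrDl addrC [y * _]mulrC [euler V y * _]mulrC addrC.
Qed.

Lemma Sint_interchange V (x : Sinf V) a b :
  s V (tens (s V (tens x a)) b) = s V (tens (s V (tens x b)) a).
Proof.
(* The inner integrals become [a y] and [b y], and both outer tensors then have the product
   [a b y]. *)
have [y <-] := euler_succ_surj x; rewrite !Sint_tens; apply: Sint_ext.
by rewrite !coderivingE mulrAC [RHS]mulrAC [Sinf_eta V a * _]mulrC.
Qed.

Lemma Sint_integral_transformation : integral_transformation (S := Sinf_modality R) s.
Proof.
split; rewrite /Sinf_modality /=.
- by move=> A B h m; exact: Sint_natural.
- move=> A; apply: (@tensor_ext _ _ _ _ (s A \o tmap (Sinf_unit A) idfun)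
    (Sinf_eta A \o @tunitl R A)) => r a.
  rewrite -[LHS]/(s A (tmap _ _ _)) tmapE -[RHS]/(Sinf_eta A (tunitl A _)) tunitlE.
  exact: Sint_unit.
- move=> A; pose m := Sinf_mul A; apply: (@tensor4_ext _ _ _ _ _ (m \o tmap (s A) (s A))
      ((s A \o tmap m idfun \o @tassoci R (Sinf A) (Sinf A) A
         \o tmap (s A) (idfun : {linear Sinf A \ox A -> Sinf A \ox A}))
      \+
      (s A \o tmap m idfun \o @tassoci R (Sinf A) (Sinf A) A
         \o tmap idfun (@tsym R A (Sinf A)) \o @tassoc R (Sinf A) A (Sinf A)
         \o tmap (idfun : {linear Sinf A \ox A -> Sinf A \ox A}) (s A)))) => x a y b.
  rewrite /= !tmapE tassocE tmapE /= tsymE !tassociE !tmapE /m !Sinf_mulE /=.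
  exact: Sint_rota_baxter.
- move=> A; apply: (@tensor3_ext _ _ _ _ (s A \o tmap (s A) idfun)
      (s A \o tmap (s A) idfun \o @tassoci R (Sinf A) A A
        \o tmap idfun (@tsym R A A) \o @tassoc R (Sinf A) A A)) => x a b.
  rewrite /= tmapE tassocE tmapE /= tsymE tassociE tmapE.
  exact: Sint_interchange.
Qed.

Lemma Sint_one_form n (w : 'I_n -> Cinf R n) :
  s 'rV[R]_n (one_form w) =
  \sum_i Sinf_eta 'rV[R]_n 'e_i * Sinf_of_Cinf (Cinf_radial (w i)).
Proof.
rewrite linear_sum; apply: eq_bigr => i _.
by rewrite -Sint_tens /Sinf_of_Cinf euler_radial.
Qed.

Lemma Sint_line_integral n (w : 'I_n -> Cinf R n) (v : 'rV[R]_n) :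
  Cinf_of_Sinf R n (s 'rV[R]_n (one_form w)) v = line_integral w (segment v).
Proof.
rewrite Sint_one_form ch_sum Cinf_ring_sumE /line_integral.
transitivity (\sum_i v 0 i * radial_mean 0 (w i) v).
  apply: eq_bigr => i _; rewrite ch_mul Cinf_ringM Sinf_of_CinfK; congr (_ * _).
  rewrite Sinf_lift_eta coord_funE (bigD1 i)//= mxE !eqxx mul1r big1 ?addr0// => j /negPf ji.
  by rewrite mxE ji mul0r.
have cw i : continuous (w i).
  by move=> y; apply: differentiable_continuous; apply: Cinf_differentiable.
have cr i : continuous (fun t : R => t ^+ 0 * w i (t *: v)) by exact: radial_continuous.
(* The segment has constant velocity [v], so the line integral is [\sum_i v 0 i] times the radial
   mean of [w i] at [v]. *)
have segE t : 'D_1 (segment v) t = v.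
  rewrite deriveE ?diffZl//=.
  by rewrite diff_val /= scale1r.
transitivity (\int[lebesgue_measure]_(t in `[0%R, 1%R]%classic)
    (\sum_i v 0 i * (t ^+ 0 * w i (t *: v)))).
  rewrite Rintegral01_sum; last first.
    by move=> i t; apply: cvgM; [exact: cvg_cst|exact: cr].
  by apply: eq_bigr => i _; rewrite RintegralZl//; exact: continuous_integrable01.
apply: eq_Rintegral => t _; apply: eq_bigr => i _.
by rewrite segE expr0 mul1r mulrC.
Qed.
End Integral.
End Modality.

Theorem theorem6p6 (R : realType) :
  exists d : forall V : lmodType R, {linear Sinf V -> Sinf V \ox V},
  [/\ is_deriving d,
      (forall d' : forall V : lmodType R, {linear Sinf V -> Sinf V \ox V},
         is_deriving d' -> forall V : lmodType R, d' V =1 d V) &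
      exists Kinv : forall V : lmodType R, {linear Sinf V -> Sinf V},
      (forall V : lmodType R,
         cancel (Kmap d V) (Kinv V) /\ cancel (Kinv V) (Kmap d V)) /\
      let s (V : lmodType R) : {linear Sinf V \ox V -> Sinf V} :=
        Kinv V \o coderiving V in
      co_integral (S := Sinf_modality R) s /\
      (forall (n : nat) (w : 'I_n -> Cinf R n) (v : 'rV[R]_n),
         Cinf_of_Sinf R n (s 'rV[R]_n (one_form w)) v =
         line_integral w (segment v))].
Proof.
exists (@Sinf_d R); split; [exact: is_deriving_Sinf_d|exact: deriving_unique|].
pose Kinv (V : lmodType R) := projT1 (cid (Kmap_inverse V)).
have KinvP V : cancel (Kmap (@Sinf_d R) V) (Kinv V) /\ cancel (Kinv V) (Kmap (@Sinf_d R) V).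
  exact: projT2 (cid (Kmap_inverse V)).
exists Kinv; split=> // s.
have Ks V m : Kmap (@Sinf_d R) V (s V m) = coderiving V m by exact: (KinvP V).2.
split; last by move=> n w v; exact: Sint_line_integral.
by split; [exact: Sinf_algebra_modality|exact: Sint_integral_transformation].
Qed.
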